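(* Let $M$ be an $n$-dimensional compact manifold and let $(g_{ij}(t),A_i(t),B_{ij}(t))$ be a smooth solution on $M$ (Riemannian metrics, one-forms, two-forms) of the flow $$\frac{\partial g_{ij}}{\partial t}=-2\left[R_{ij}-\frac14H_{ikl}H_j{}^{kl}-F_i{}^kF_{jk}\right],\qquad \frac{\partial A_i}{\partial t}=-\nabla_kF_i{}^k,\qquad \frac{\partial B_{ij}}{\partial t}=\nabla_kH^k{}_{ij}.$$ Then the scalar curvature satisfies the evolution equation $$\begin{aligned}\frac{\partial}{\partial t}R&=\triangle R+2|Ric|^2+\frac12g^{jl}g^{ik}\big[\nabla_i\nabla_l(H_{kpq}H_j{}^{pq})-\nabla_i\nabla_k(H_{jpq}H_l{}^{pq})\big]\\&\quad+2g^{jl}g^{ik}\big[\nabla_i\nabla_l(F_k{}^pF_{jp})-\nabla_i\nabla_k(F_j{}^pF_{lp})\big]-g^{ip}R_{ik}\left(\frac12H_{pmn}H^{kmn}+2F_{pm}F^{km}\right).\end{aligned}$$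
   Context: $F=dA$, $H=dB$, i.e. $F_{ij}=\partial_iA_j-\partial_jA_i$ and $H_{ijk}=\partial_iB_{jk}+\partial_jB_{ki}+\partial_kB_{ij}$. Indices are raised and lowered with the evolving metric $g$, repeated indices are summed, $\nabla$ is its Levi-Civita connection with Christoffel symbols $\Gamma^k_{ij}$, and $\triangle=g^{ij}\nabla_i\nabla_j$. Curvature conventions: $R^k_{ijl}=\partial_i\Gamma^k_{jl}-\partial_j\Gamma^k_{il}+\Gamma^k_{ip}\Gamma^p_{jl}-\Gamma^k_{jp}\Gamma^p_{il}$, $R_{ijkl}=g_{kp}R^p_{ijl}$, $R_{ik}=g^{jl}R_{ijkl}$, $R=g^{ij}R_{ij}$, $|Ric|^2=g^{ip}g^{kq}R_{ik}R_{pq}$. *)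

(* Defs.v *)
From HB Require Import structures.
From mathcomp Require Import all_boot all_order all_algebra.
From mathcomp Require Import all_classical all_reals all_analysis.

Set Implicit Arguments.
Unset Strict Implicit.
Unset Printing Implicit Defensive.

Import Order.TTheory GRing.Theory Num.Theory.
Import numFieldNormedType.Exports.

Local Open Scope classical_set_scope.
Local Open Scope ring_scope.

Section Calculus.
Context {R : realType} {n : nat}.

Definition pd (i : 'I_n) (f : 'rV[R]_n -> R) : 'rV[R]_n -> R :=
  fun x => 'D_(delta_mx 0 i) f x.

Definition smooth_on (V : set 'rV[R]_n) (f : 'rV[R]_n -> R) : Prop :=
  forall (s : seq 'I_n) x, V x ->
    {for x, continuous (foldr pd f s)} /\
    forall i, derivable (foldr pd f s) x (delta_mx 0 i).

(* The difference quotient only uses times in J, so the derivative is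
   one-sided at an endpoint of J that belongs to J, and the ordinary
   derivative at the interior points of J. *)
Definition time_quot (f : R -> R) (t : R) : R -> R :=
  fun s => (f s - f t) / (s - t).

Definition has_dt (J : set R) (f : R -> R) (t l : R) : Prop :=
  time_quot f t s @[s --> within J t^'] --> l.

Definition dt (J : set R) (f : R -> R) (t : R) : R :=
  lim (time_quot f t s @[s --> within J t^']).

(* [None] is the time direction, [Some i] the i-th space direction. *)
Definition stpd (J : set R) (a : option 'I_n) (f : R -> 'rV[R]_n -> R) :
    R -> 'rV[R]_n -> R :=
  match a with
  | None => fun t x => dt J (f ^~ x) t
  | Some i => fun t => pd i (f t)
  end.

(* Smoothness up to the endpoints of J: the space-time derivatives of all
   orders exist and are jointly continuous on J `*` V. *)
Definition st_smooth_on (J : set R) (V : set 'rV[R]_n)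
    (f : R -> 'rV[R]_n -> R) : Prop :=
  forall s : seq (option 'I_n), let h := foldr (stpd J) f s in
    {within J `*` V, continuous (fun z : R * 'rV[R]_n => h z.1 z.2)} /\
    forall t x, J t -> V x ->
      cvg (time_quot (h ^~ x) t u @[u --> within J t^']) /\
      forall i, derivable (h t) x (delta_mx 0 i).

End Calculus.

(* A smooth n-manifold presented by a smooth atlas.  The chart [a] is
   [chart_map a] restricted to [chart_dom a], with inverse [chart_inv a]; the values of these
   functions outside [chart_dom a] and [chart_codom a] are irrelevant. *)
Record manifold (R : realType) (n : nat) := Manifold {
  carrier :> topologicalType;
  chart : Type;
  chart_dom : chart -> set carrier;
  chart_map : chart -> carrier -> 'rV[R]_n;
  chart_inv : chart -> 'rV[R]_n -> carrier;
  manifold_hausdorff : hausdorff_space carrier;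
  manifold_second_countable : @second_countable carrier;
  chart_dom_open : forall a, open (chart_dom a);
  chart_dom_cover : forall p, exists a, chart_dom a p;
  chart_codom_open : forall a, open (chart_map a @` chart_dom a);
  chart_mapK : forall a p, chart_dom a p -> chart_inv a (chart_map a p) = p;
  chart_map_continuous : forall a,
    {within chart_dom a, continuous (chart_map a)};
  chart_inv_continuous : forall a,
    {within chart_map a @` chart_dom a, continuous (chart_inv a)};
  transition_smooth : forall a b (i : 'I_n),
    smooth_on (chart_map a @` (chart_dom a `&` chart_dom b))
      (fun x => chart_map b (chart_inv a x) 0 i)
}.

Definition chart_codom (R : realType) (n : nat) (M : manifold R n) (a : chart M) :
    set 'rV[R]_n :=
  chart_map a @` chart_dom a.

Section TensorCalculus.
Context {R : realType} {n : nat}.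

(* Component functions in a chart; no transformation law is imposed here. *)
Definition tfield (r : nat) := 'rV[R]_n -> r.-tuple 'I_n -> R.

Definition upd_index r (I : r.-tuple 'I_n) (s : 'I_r) (p : 'I_n) : r.-tuple 'I_n :=
  [tuple if u == s then p else tnth I u | u < r].

Definition ginv (g : tfield 2) (x : 'rV[R]_n) (i j : 'I_n) : R :=
  invmx (\matrix_(k, l) g x [tuple k; l]) i j.

Definition raise (g : tfield 2) r (s : 'I_r) (T : tfield r) : tfield r :=
  fun x I => \sum_(p < n) ginv g x (tnth I s) p * T x (upd_index I s p).

(* christoffel g x k i j is Gamma^k_{ij}. *)
Definition christoffel (g : tfield 2) (x : 'rV[R]_n) (k i j : 'I_n) : R :=
  2^-1 * \sum_(l < n) ginv g x k l *
    (pd i (fun y => g y [tuple j; l]) x + pd j (fun y => g y [tuple i; l]) x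
     - pd l (fun y => g y [tuple i; j]) x).

(* The covariant derivative of a tensor whose upper slots are those in U; the
   new lower index comes first: (cov g U T) x (k :: I) = (nabla_k T)_I. *)
Definition cov (g : tfield 2) r (U : pred 'I_r) (T : tfield r) : tfield r.+1 :=
  fun x K => let k := thead K in let I := behead_tuple K in
    pd k (fun y => T y I) x +
    \sum_(s < r)
      if U s
      then \sum_(p < n) christoffel g x (tnth I s) k p * T x (upd_index I s p)
      else - \sum_(p < n) christoffel g x p k (tnth I s) * T x (upd_index I s p).

(* (hess g T) x [tuple i, j & I] = (nabla_i nabla_j T)_I, for T with only lower
   indices. *)
Definition hess (g : tfield 2) r (T : tfield r) : tfield r.+2 :=
  cov g pred0 (cov g pred0 T).

(* riem_up g x k i j l is R^k_{ijl}. *)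
Definition riem_up (g : tfield 2) (x : 'rV[R]_n) (k i j l : 'I_n) : R :=
  pd i (fun y => christoffel g y k j l) x
  - pd j (fun y => christoffel g y k i l) x
  + \sum_(p < n) christoffel g x k i p * christoffel g x p j l
  - \sum_(p < n) christoffel g x k j p * christoffel g x p i l.

Definition riem (g : tfield 2) (x : 'rV[R]_n) (i j k l : 'I_n) : R :=
  \sum_(p < n) g x [tuple k; p] * riem_up g x p i j l.

Definition ric (g : tfield 2) (x : 'rV[R]_n) (i k : 'I_n) : R :=
  \sum_(j < n) \sum_(l < n) ginv g x j l * riem g x i j k l.

Definition scal (g : tfield 2) (x : 'rV[R]_n) : R :=
  \sum_(i < n) \sum_(j < n) ginv g x i j * ric g x i j.

Definition ric_normsq (g : tfield 2) (x : 'rV[R]_n) : R :=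
  \sum_(i < n) \sum_(p < n) \sum_(k < n) \sum_(q < n)
    ginv g x i p * ginv g x k q * ric g x i k * ric g x p q.

Definition laplacian (g : tfield 2) (f : 'rV[R]_n -> R) (x : 'rV[R]_n) : R :=
  \sum_(i < n) \sum_(j < n)
    ginv g x i j * hess g (fun y (_ : 0.-tuple 'I_n) => f y) x [tuple i; j].

Definition d1 (A : tfield 1) : tfield 2 :=
  fun x I => let i := tnth I 0 in let j := tnth I 1 in
    pd i (fun y => A y [tuple j]) x - pd j (fun y => A y [tuple i]) x.

Definition d2 (B : tfield 2) : tfield 3 :=
  fun x I => let i := tnth I 0 in let j := tnth I 1 in let k := tnth I 2 in
    pd i (fun y => B y [tuple j; k]) x + pd j (fun y => B y [tuple k; i]) x
    + pd k (fun y => B y [tuple i; j]) x.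

(* H_{ikl} H_j^{kl} *)
Definition HH (g : tfield 2) (H : tfield 3) : tfield 2 :=
  fun x I => let i := tnth I 0 in let j := tnth I 1 in
    \sum_(k < n) \sum_(l < n)
      H x [tuple i; k; l] * raise g 1 (raise g 2 H) x [tuple j; k; l].

(* F_i^k F_{jk} *)
Definition FF (g : tfield 2) (F : tfield 2) : tfield 2 :=
  fun x I => let i := tnth I 0 in let j := tnth I 1 in
    \sum_(k < n) raise g 1 F x [tuple i; k] * F x [tuple j; k].

(* nabla_k F_i^k *)
Definition divF (g : tfield 2) (F : tfield 2) (x : 'rV[R]_n) (i : 'I_n) : R :=
  \sum_(k < n) cov g (pred1 1) (raise g 1 F) x [tuple k; i; k].

(* nabla_k H^k_{ij} *)
Definition divH (g : tfield 2) (H : tfield 3) (x : 'rV[R]_n) (i j : 'I_n) : R :=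
  \sum_(k < n) cov g (pred1 0) (raise g 0 H) x [tuple k; k; i; j].

End TensorCalculus.

Arguments tfield : clear implicits.

Section TensorFields.
Context {R : realType} {n : nat} (M : manifold R n).

Definition is_tensor r (T : chart M -> tfield R n r) : Prop :=
  forall (a b : chart M) (p : M), chart_dom a p -> chart_dom b p ->
    forall I : r.-tuple 'I_n,
      T b (chart_map b p) I =
      \sum_(K : r.-tuple 'I_n)
        (\prod_(s < r)
           pd (tnth I s) (fun y => chart_map a (chart_inv b y) 0 (tnth K s))
              (chart_map b p)) *
        T a (chart_map a p) K.

(* A smooth family, over t in J, of covariant r-tensor fields on M, given by
   its components in each chart. *)
Definition smooth_tensor_family (J : set R) r
    (T : R -> chart M -> tfield R n r) : Prop :=
  (forall t, J t -> is_tensor (T t)) /\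
  (forall a I, st_smooth_on J (chart_codom a) (fun t x => T t a x I)).

Definition riemannian (g : chart M -> tfield R n 2) : Prop :=
  forall a x, chart_codom a x ->
    (forall i j, g a x [tuple i; j] = g a x [tuple j; i]) /\
    (forall v : 'rV[R]_n, v != 0 ->
       0 < \sum_(i < n) \sum_(j < n) g a x [tuple i; j] * v 0 i * v 0 j).

Definition antisymmetric2 (B : chart M -> tfield R n 2) : Prop :=
  forall a x, chart_codom a x ->
    forall i j, B a x [tuple i; j] = - B a x [tuple j; i].

Definition flow_solution (J : set R) (g : R -> chart M -> tfield R n 2)
    (A : R -> chart M -> tfield R n 1) (B : R -> chart M -> tfield R n 2) : Prop :=
  forall (a : chart M) t x, J t -> chart_codom a x ->
    let gt := g t a in let F := d1 (A t a) in let H := d2 (B t a) in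
    [/\ forall i j,
          has_dt J (fun s => g s a x [tuple i; j]) t
            (- 2 * (ric gt x i j - 4^-1 * HH gt H x [tuple i; j]
                    - FF gt F x [tuple i; j])),
        forall i,
          has_dt J (fun s => A s a x [tuple i]) t (- divF gt F x i)
      & forall i j,
          has_dt J (fun s => B s a x [tuple i; j]) t (divH gt H x i j)].

Record smooth_flow (J : set R) (g : R -> chart M -> tfield R n 2)
    (A : R -> chart M -> tfield R n 1) (B : R -> chart M -> tfield R n 2) : Prop :=
  SmoothFlow {
    flow_g_smooth : smooth_tensor_family J g;
    flow_A_smooth : smooth_tensor_family J A;
    flow_B_smooth : smooth_tensor_family J B;
    flow_g_riemannian : forall t, J t -> riemannian (g t);
    flow_B_form : forall t, J t -> antisymmetric2 (B t);
    flow_equations : flow_solution J g A B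
  }.

End TensorFields.

(* Main.v *)
Require Import Defs.
From HB Require Import structures.
From mathcomp Require Import all_boot all_order all_algebra.
From mathcomp Require Import all_classical all_reals all_analysis.
From mathcomp Require Import perm ring lra.

Set Implicit Arguments.
Unset Strict Implicit.
Unset Printing Implicit Defensive.

Import Order.TTheory GRing.Theory Num.Theory.
Import numFieldNormedType.Exports.

Local Open Scope classical_set_scope.
Local Open Scope ring_scope.

(** The identity is local, so it is proved in one chart.  Contracting the
    curvature as R = g^{jl} R^i_{ijl} and differentiating in time, with
    h = dg/dt and C = dGamma/dt, gives the general variation formula
      dR/dt = nabla^k (nabla^l h_{kl} - nabla_k (tr h)) - h^{jl} R_{jl},
    because the variation of R^k_{ijl} is nabla_i C^k_{jl} - nabla_j C^k_{il}
    and C is the Christoffel expression with the covariant derivatives of h in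
    place of the partial derivatives of g ([D_Riem], [D_Gamma_low], [D_Scal]).
    Along the flow h = -2 Ric + S with S = HH / 2 + 2 FF.  The contracted Bianchi
    identity nabla^l R_{kl} = nabla_k R / 2 ([d_Scal]) turns the Ricci part of the
    divergence into the Laplacian of R and the algebraic part into 2 |Ric|^2, and
    the rest of the right-hand side is the contribution of S ([D_Scal_flow]).

    All these identities are consequences of three facts: the derivatives in the
    coordinates and in time are additive, satisfy the Leibniz rule, and commute.
    They are therefore proved over an arbitrary commutative ring with commuting
    derivations, where no differentiability side condition is ever met.  The
    analysis consists in building one such ring: the functions on the product
    of the time interval and the coordinate domain whose space-time derivatives
    of all orders exist and are continuous.  Closure of this class under ring
    operations, and under inversion of nowhere vanishing functions, is an
    induction on the order of differentiation ([CkD], [CkM], [CkV]); the inverse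
    metric belongs to it by the cofactor formula ([smooth_ginv]).  Commutation of
    the derivatives ([stpdC]) is Schwarz's theorem, in a form that admits
    one-sided time derivatives at the ends of the interval
    ([mixed_derivative]).  Evaluation at a point sends each ring-theoretic
    curvature quantity to the corresponding real number. *)

(** * Riemannian geometry over a ring with commuting derivations *)

Record derivation (A : comPzRingType) (f : A -> A) : Prop := Derivation {
  derD : forall x y, f (x + y) = f x + f y;
  derM : forall x y, f (x * y) = f x * y + x * f y
}.

Section Derivation.
Context {A : comPzRingType} {f : A -> A} (df : derivation f).

Lemma der0 : f 0 = 0.
Proof. by apply: (@addrI _ (f 0)); rewrite -(derD df) !addr0. Qed.

Lemma derN x : f (- x) = - f x.
Proof. by apply: (@addrI _ (f x)); rewrite -(derD df) !subrr der0. Qed.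

Lemma derB x y : f (x - y) = f x - f y.
Proof. by rewrite (derD df) derN. Qed.

Lemma der_sum (I : Type) (r : seq I) (F : I -> A) :
  f (\sum_(i <- r) F i) = \sum_(i <- r) f (F i).
Proof. exact: (big_morph f (derD df) der0). Qed.

Lemma der1 : f 1 = 0.
Proof.
apply: (@addrI _ (f 1)); rewrite addr0.
by rewrite -[in RHS](mulr1 1) (derM df) mulr1 mul1r.
Qed.

Lemma der_nat m : f m%:R = 0.
Proof. by elim: m => [|m IH]; rewrite ?der0 // mulrS (derD df) der1 IH addr0. Qed.

(** From c + c = 1 one gets f c + f c = 0, and f c is recovered as c times
    that; so no division is needed in the ring. *)
Lemma der_half c : c + c = 1 -> f c = 0.
Proof.
move=> c2; have fc2 : f c + f c = 0 by rewrite -(derD df) c2 der1.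
by rewrite -[f c]mul1r -c2 mulrDl -mulrDr fc2 mulr0.
Qed.

End Derivation.

Section Riemann.
Context {A : comPzRingType} {n : nat} (d : 'I_n -> A -> A).
Context (G Gi : 'I_n -> 'I_n -> A) (half : A).

(** Trace with respect to the inverse metric.  Throughout, [d i] plays the role of
    the i-th coordinate derivative, [G] of the metric, [Gi] of its inverse and
    [half] of the constant one half. *)
Definition tr (T : 'I_n -> 'I_n -> A) : A := \sum_j \sum_l Gi j l * T j l.

(** [Gamma k i j], [Riem k i j l], [Riem_low i j k l] and [Ric i k] follow the index
    conventions of Gamma^k_{ij}, R^k_{ijl}, R_{ijkl} and R_{ik}. *)
Definition Gamma (k i j : 'I_n) : A :=
  half * \sum_l Gi k l * (d i (G j l) + d j (G i l) - d l (G i j)).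

Definition Riem (k i j l : 'I_n) : A :=
  d i (Gamma k j l) - d j (Gamma k i l)
  + \sum_p Gamma k i p * Gamma p j l - \sum_p Gamma k j p * Gamma p i l.

Definition Riem_low (i j k l : 'I_n) : A := \sum_p G k p * Riem p i j l.

Definition Ric (i k : 'I_n) : A := tr (fun j l => Riem_low i j k l).

Definition Scal : A := tr Ric.

Definition cov1 (k : 'I_n) (v : 'I_n -> A) (i : 'I_n) : A :=
  d k (v i) - \sum_p Gamma p k i * v p.

Definition cov2 (k : 'I_n) (T : 'I_n -> 'I_n -> A) (i j : 'I_n) : A :=
  d k (T i j) - \sum_p Gamma p k i * T p j - \sum_p Gamma p k j * T i p.

Definition cov3 (k : 'I_n) (T : 'I_n -> 'I_n -> 'I_n -> A) (i j l : 'I_n) : A :=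
  d k (T i j l) - \sum_p Gamma p k i * T p j l - \sum_p Gamma p k j * T i p l
  - \sum_p Gamma p k l * T i j p.

(** nabla_k R^m_{ijl}, the only covariant derivative of a tensor with an upper index
    that occurs besides that of the variation of the connection. *)
Definition cov_Riem (k m i j l : 'I_n) : A :=
  d k (Riem m i j l) + \sum_p Gamma m k p * Riem p i j l - \sum_p Gamma p k i * Riem m p j l
  - \sum_p Gamma p k j * Riem m i p l - \sum_p Gamma p k l * Riem m i j p.

Lemma eq_tr T U : (forall i j, T i j = U i j) -> tr T = tr U.
Proof. by move=> TU; apply: eq_bigr => i _; apply: eq_bigr => j _; rewrite TU. Qed.

Lemma trD T U : tr (fun i j => T i j + U i j) = tr T + tr U.
Proof.
rewrite /tr -big_split; apply: eq_bigr => i _ /=.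
by rewrite -big_split; apply: eq_bigr => j _ /=; rewrite mulrDr.
Qed.

Lemma trZ c T : tr (fun i j => c * T i j) = c * tr T.
Proof.
rewrite /tr mulr_sumr; apply: eq_bigr => i _; rewrite mulr_sumr.
by apply: eq_bigr => j _; ring.
Qed.

Lemma trN T : tr (fun i j => - T i j) = - tr T.
Proof. by rewrite -mulN1r -trZ; apply: eq_tr => i j; rewrite mulN1r. Qed.

Lemma trB T U : tr (fun i j => T i j - U i j) = tr T - tr U.
Proof. by rewrite -trN -trD. Qed.

Lemma tr_sum (F : 'I_n -> 'I_n -> 'I_n -> A) :
  tr (fun i j => \sum_p F p i j) = \sum_p tr (F p).
Proof.
rewrite /tr [RHS]exchange_big; apply: eq_bigr => i _ /=; rewrite [RHS]exchange_big.
by apply: eq_bigr => j _; rewrite mulr_sumr.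
Qed.

Lemma sum_delta i (F : 'I_n -> A) : \sum_p (i == p)%:R * F p = F i.
Proof.
rewrite (bigD1 i) //= eqxx mul1r big1 ?addr0 // => p pi.
by rewrite eq_sym (negPf pi) mul0r.
Qed.

Context (dder : forall i, derivation (d i)).
Context (dC : forall i j a, d i (d j a) = d j (d i a)).
Context (Gsym : forall i j, G i j = G j i) (Gisym : forall i j, Gi i j = Gi j i).
Context (GGi : forall i j, \sum_p G i p * Gi p j = (i == j)%:R).
Context (half2 : half + half = 1).

Lemma GiG i j : \sum_p Gi i p * G p j = (i == j)%:R.
Proof.
rewrite eq_sym -GGi; apply: eq_bigr => p _.
by rewrite mulrC Gsym Gisym.
Qed.

Lemma GGiK F m : \sum_p G m p * (\sum_l Gi p l * F l) = F m.
Proof.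
under eq_bigr do rewrite mulr_sumr.
rewrite exchange_big -[RHS](sum_delta m); apply: eq_bigr => l _ /=.
by rewrite -GGi mulr_suml; apply: eq_bigr => p _; rewrite mulrA.
Qed.

Lemma GiGK F m : \sum_p Gi m p * (\sum_l G p l * F l) = F m.
Proof.
under eq_bigr do rewrite mulr_sumr.
rewrite exchange_big -[RHS](sum_delta m); apply: eq_bigr => l _ /=.
by rewrite -GiG mulr_suml; apply: eq_bigr => p _; rewrite mulrA.
Qed.

Lemma G_inj F F' : (forall m, \sum_p G m p * F p = \sum_p G m p * F' p) ->
  forall m, F m = F' m.
Proof.
by move=> FF m; rewrite -[LHS]GiGK -[RHS]GiGK; apply: eq_bigr => p _; rewrite FF.
Qed.

(** f (g^-1) = - g^-1 (f g) g^-1, obtained by applying f to g g^-1 = 1. *)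
Lemma der_inv_metric f i j : derivation f ->
  f (Gi i j) = - \sum_p \sum_q Gi i p * f (G p q) * Gi q j.
Proof.
move=> df; apply: (G_inj (F := fun i => f (Gi i j))
  (F' := fun i => - \sum_p \sum_q Gi i p * f (G p q) * Gi q j)) => m.
have /eqP := congr1 f (GGi m j); rewrite (der_nat df) (der_sum df).
under eq_bigr do rewrite (derM df).
rewrite big_split /= addrC addr_eq0 => /eqP ->.
rewrite -(GGiK (fun p => \sum_q f (G p q) * Gi q j)) -sumrN.
apply: eq_bigr => p _; rewrite mulrN; congr (- (_ * _)).
by apply: eq_bigr => q _; rewrite mulr_sumr; apply: eq_bigr => r _; ring.
Qed.

Lemma Gamma_sym k i j : Gamma k i j = Gamma k j i.
Proof.
by congr (_ * _); apply: eq_bigr => l _; rewrite (Gsym i j); ring.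
Qed.

Lemma Gamma_low m i j :
  \sum_p G m p * Gamma p i j = half * (d i (G j m) + d j (G i m) - d m (G i j)).
Proof.
rewrite -(GGiK (fun l => half * (d i (G j l) + d j (G i l) - d l (G i j)))).
apply: eq_bigr => p _; congr (_ * _); rewrite /Gamma mulr_sumr.
by apply: eq_bigr => l _; ring.
Qed.

Lemma d_metric_low k i j :
  d k (G i j) = \sum_p G j p * Gamma p k i + \sum_p G i p * Gamma p k j.
Proof.
rewrite !Gamma_low (Gsym j i) (Gsym k i) (Gsym k j) (Gsym i k).
rewrite -[LHS]mul1r -half2; ring.
Qed.

(** The Levi-Civita connection preserves the metric. *)
Lemma d_metric k i j :
  d k (G i j) = \sum_p Gamma p k i * G p j + \sum_p Gamma p k j * G i p.
Proof.
rewrite d_metric_low; congr (_ + _); apply: eq_bigr => p _; first by rewrite Gsym mulrC.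
by rewrite mulrC.
Qed.

Lemma d_inv_metric k i j :
  d k (Gi i j) = - (\sum_p Gamma i k p * Gi p j + \sum_p Gamma j k p * Gi i p).
Proof.
rewrite (der_inv_metric _ _ (dder k)); congr (- _).
under eq_bigr do under eq_bigr do rewrite d_metric mulrDr mulrDl.
under eq_bigr do rewrite big_split /=.
rewrite big_split /= addrC; congr (_ + _).
  transitivity (\sum_q (\sum_p Gi i p * (\sum_r G p r * Gamma r k q)) * Gi q j).
    rewrite exchange_big; apply: eq_bigr => q _; rewrite mulr_suml.
    apply: eq_bigr => p _; congr (_ * _ * _).
    by apply: eq_bigr => r _; rewrite mulrC.
  by apply: eq_bigr => q _; rewrite GiGK.
apply: eq_bigr => p _.
transitivity (Gi i p * \sum_q Gi j q * (\sum_r G q r * Gamma r k p)).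
  rewrite mulr_sumr; apply: eq_bigr => q _.
  rewrite -mulrA (Gisym q j) [X in _ * X]mulrC; congr (_ * (_ * _)).
  by apply: eq_bigr => r _; rewrite mulrC Gsym.
by rewrite GiGK mulrC.
Qed.

(** Since the inverse metric is parallel, contracting with it commutes with
    covariant differentiation. *)
Lemma tr_cov2 k T : tr (cov2 k T) = d k (tr T).
Proof.
rewrite {2}/tr (der_sum (dder k)).
under eq_bigr do rewrite (der_sum (dder k)).
under eq_bigr do under eq_bigr do rewrite (derM (dder k)) addrC.
under eq_bigr do rewrite big_split /=.
rewrite big_split /= /cov2 !trB -addrA; congr (_ + _).
under [RHS]eq_bigr do under eq_bigr do rewrite d_inv_metric mulNr mulrDl opprD.
under [RHS]eq_bigr do rewrite big_split /= !sumrN.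
rewrite big_split /= !sumrN; congr (- _ - _).
  rewrite /tr; under eq_bigr do under eq_bigr do rewrite mulr_sumr.
  under [RHS]eq_bigr do under eq_bigr do rewrite mulr_suml.
  under eq_bigr do rewrite exchange_big /=; rewrite exchange_big /=.
  apply: eq_bigr => p _; rewrite exchange_big /=.
  by apply: eq_bigr => l _; apply: eq_bigr => j _; ring.
rewrite /tr; apply: eq_bigr => j _.
under [LHS]eq_bigr do rewrite mulr_sumr.
under [RHS]eq_bigr do rewrite mulr_suml.
by rewrite exchange_big /=; apply: eq_bigr => p _; apply: eq_bigr => l _; ring.
Qed.

Lemma tr_cov3 k i T :
  tr (cov3 k T i) = cov1 k (fun i => tr (T i)) i.
Proof.
rewrite /cov1 -tr_cov2.
transitivity (tr (fun j l => cov2 k (T i) j l - \sum_p Gamma p k i * T p j l)).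
  by apply: eq_tr => j l; rewrite /cov2 /cov3; ring.
by rewrite trB tr_sum; congr (_ - _); apply: eq_bigr => p _; rewrite trZ.
Qed.

(** The trace of nabla v is the divergence of the vector field obtained by
    raising the index of v. *)
Lemma tr_cov1 v :
  tr (fun i k => cov1 i v k) =
  \sum_i (d i (\sum_k Gi i k * v k) + \sum_p Gamma i i p * (\sum_k Gi p k * v k)).
Proof.
rewrite /tr; apply: eq_bigr => i _; rewrite (der_sum (dder i)).
under [X in _ = X + _]eq_bigr do rewrite (derM (dder i)) d_inv_metric.
under [X in _ = _ + X]eq_bigr do rewrite mulr_sumr.
rewrite [X in _ = _ + X]exchange_big -big_split /=.
transitivity (\sum_k Gi i k * d i (v k)
              - \sum_k (\sum_p Gamma k i p * Gi i p) * v k).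
  rewrite /cov1; under eq_bigr do rewrite mulrBr mulr_sumr.
  rewrite sumrB; congr (_ - _); rewrite exchange_big.
  by apply: eq_bigr => k _; rewrite mulr_suml; apply: eq_bigr => p _; ring.
rewrite -sumrB; apply: eq_bigr => k _.
rewrite (_ : \sum_p Gamma i i p * (Gi p k * v k) = (\sum_p Gamma i i p * Gi p k) * v k);
  first by ring.
by rewrite mulr_suml; apply: eq_bigr => p _; ring.
Qed.

Lemma RiemN k i j l : Riem k i j l = - Riem k j i l.
Proof. by rewrite /Riem; ring. Qed.

(** The correction term is quadratic in Gamma and symmetric under the exchange of
    (i, m) with (j, l), which is why it disappears from [Riem_low_skew]. *)
Lemma d_Gamma_low i j m l :
  d i (\sum_p G m p * Gamma p j l) =
  \sum_p G m p * (d i (Gamma p j l) + \sum_q Gamma p i q * Gamma q j l)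
  + \sum_q Gamma q i m * (\sum_p G q p * Gamma p j l).
Proof.
transitivity (\sum_p G m p * d i (Gamma p j l)
  + \sum_p \sum_q Gamma q i p * G m q * Gamma p j l
  + \sum_p \sum_q Gamma q i m * G q p * Gamma p j l).
  rewrite (der_sum (dder i)) -!big_split; apply: eq_bigr => p _ /=.
  by rewrite (derM (dder i)) d_metric mulrDl !mulr_suml; ring.
congr (_ + _); last first.
  rewrite exchange_big; apply: eq_bigr => q _ /=; rewrite mulr_sumr.
  by apply: eq_bigr => p _; rewrite mulrA.
under [RHS]eq_bigr do rewrite mulrDr.
rewrite big_split /=; congr (_ + _).
rewrite exchange_big; apply: eq_bigr => q _ /=; rewrite mulr_sumr.
by apply: eq_bigr => p _; ring.
Qed.

(** The curvature is the commutator of covariant derivatives, and that commutator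
    kills the metric; in components, the left-hand side plus its mirror image is
    (d_i d_j - d_j d_i) g_{ml}. *)
Lemma Riem_low_skew i j m l : Riem_low i j m l = - Riem_low i j l m.
Proof.
pose L m j l := \sum_p G m p * Gamma p j l.
pose K i j m l := \sum_q Gamma q i m * L q j l.
have KC a b u v : K a b u v = K b a v u.
  rewrite /K /L; under eq_bigr do rewrite mulr_sumr.
  under [RHS]eq_bigr do rewrite mulr_sumr.
  rewrite exchange_big; apply: eq_bigr => p _; apply: eq_bigr => q _.
  by rewrite (Gsym q p); ring.
have RiemE u v : Riem_low i j u v =
    d i (L u j v) - K i j u v - (d j (L u i v) - K j i u v).
  rewrite !d_Gamma_low !addrK /Riem_low -sumrB; apply: eq_bigr => p _.
  by rewrite -mulrBr /Riem; ring.
rewrite !RiemE (KC j i) (KC j i).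
have dGL a u v : d a (G u v) = L v a u + L u a v by rewrite /L d_metric_low.
have := dC i j (G m l); rewrite !dGL !(derD (dder _)) => E.
apply/eqP; rewrite -subr_eq0; apply/eqP.
by rewrite -(subrr (d i (L l j m) + d i (L m j l))) {2}E; ring.
Qed.

(** By skew-symmetry in the last two lowered indices, the contraction that defines
    the Ricci tensor equals the trace of R^m_{ijl} over m and i, the form in which
    the metric does not appear explicitly and time differentiation is easy. *)
Lemma RicE i k : Ric i k = \sum_m Riem m m i k.
Proof.
rewrite /Ric /tr; under eq_bigr do under eq_bigr do rewrite Riem_low_skew mulrN.
under eq_bigr do rewrite sumrN GiGK.
by apply: eq_bigr => m _; rewrite RiemN opprK.
Qed.

Lemma tr_Riem m i : tr (fun j l => Riem m i j l) = \sum_k Gi m k * Ric i k.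
Proof.
rewrite -(GiGK (fun p => tr (fun j l => Riem p i j l)) m); apply: eq_bigr => k _.
rewrite /Ric /Riem_low tr_sum; congr (_ * _); apply: eq_bigr => p _.
by rewrite trZ.
Qed.

(** The terms with Gamma acting on the form indices cancel in the cyclic sum by
    symmetry of Gamma; what remains is the Jacobi identity for the matrix-valued
    operators d_i + Gamma_i, whose commutators are the curvature. *)
Lemma bianchi k i j m l :
  cov_Riem k m i j l + cov_Riem i m j k l + cov_Riem j m k i l = 0.
Proof.
(* Besides second derivatives of Gamma, expansion leaves only these sums, and
   in terms of them the cyclic sum cancels formally. *)
pose P a b c := \sum_p Gamma m a p * d b (Gamma p c l).
pose Q a b c := \sum_p d b (Gamma m a p) * Gamma p c l.
pose T a b c := \sum_p Gamma m a p * \sum_q Gamma p b q * Gamma q c l.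
pose S a b c := \sum_p Gamma p a b * Riem m p c l.
have SC a b c : S a b c = S b a c by apply: eq_bigr => p _; rewrite Gamma_sym.
have covE a b c : cov_Riem a m b c l =
    d a (d b (Gamma m c l)) - d a (d c (Gamma m b l))
    + Q b a c + P b a c - Q c a b - P c a b
    + (P a b c - P a c b + T a b c - T a c b)
    - S a b c + S a c b
    - (Q c b a - Q b c a + T b c a - T c b a).
  rewrite /cov_Riem.
  have -> : \sum_p Gamma p a c * Riem m b p l = - S a c b.
    by rewrite -sumrN; apply: eq_bigr => p _; rewrite RiemN mulrN.
  have -> : \sum_p Gamma m a p * Riem p b c l = P a b c - P a c b + T a b c - T a c b.
    by rewrite -!sumrB -big_split -sumrB /=; apply: eq_bigr => p _; rewrite /Riem; ring.
  have -> : \sum_p Gamma p a l * Riem m b c p = Q c b a - Q b c a + T b c a - T c b a.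
    have TE u v w : T u v w = \sum_p (\sum_q Gamma m u q * Gamma q v p) * Gamma p w l.
      rewrite /T; under eq_bigr do rewrite mulr_sumr.
      rewrite exchange_big; apply: eq_bigr => q _ /=; rewrite mulr_suml.
      by apply: eq_bigr => p _; rewrite mulrA.
    rewrite !TE -!sumrB -big_split -sumrB /=; apply: eq_bigr => p _.
    by rewrite /Riem; ring.
  have dS b' c' : d a (\sum_p Gamma m b' p * Gamma p c' l) = Q b' a c' + P b' a c'.
    rewrite (der_sum (dder a)) -big_split; apply: eq_bigr => p _ /=.
    by rewrite (derM (dder a)).
  rewrite {1}/Riem (derB (dder a)) (derD (dder a)) (derB (dder a)) !dS -/(S a b c).
  ring.
rewrite !covE (dC i k) (dC j k) (dC j i) (SC i k) (SC j k) (SC j i).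
ring.
Qed.

Lemma cov_RiemN k m i j l : cov_Riem k m i j l = - cov_Riem k m j i l.
Proof.
have sumN F U : (forall p, F p = - U p) -> \sum_(p < n) F p = - \sum_(p < n) U p :> A.
  by move=> FU; rewrite -sumrN; apply: eq_bigr.
rewrite /cov_Riem RiemN (derN (dder k)).
rewrite (sumN (fun p => Gamma m k p * Riem p i j l) (fun p => Gamma m k p * Riem p j i l));
  last by move=> p; rewrite RiemN mulrN.
rewrite (sumN (fun p => Gamma p k i * Riem m p j l) (fun p => Gamma p k i * Riem m j p l));
  last by move=> p; rewrite RiemN mulrN.
rewrite (sumN (fun p => Gamma p k j * Riem m i p l) (fun p => Gamma p k j * Riem m p i l));
  last by move=> p; rewrite RiemN mulrN.
rewrite (sumN (fun p => Gamma p k l * Riem m i j p) (fun p => Gamma p k l * Riem m j i p));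
  last by move=> p; rewrite RiemN mulrN.
ring.
Qed.

(** Contracting the upper index with the first form index of the curvature
    commutes with nabla: the connection terms of the two contracted slots cancel. *)
Lemma trace_cov_Riem j i l : \sum_m cov_Riem j m m i l = cov2 j Ric i l.
Proof.
rewrite /cov_Riem !sumrB big_split /=.
rewrite (_ : \sum_m \sum_p Gamma m j p * Riem p m i l =
             \sum_m \sum_p Gamma p j m * Riem m p i l); last by rewrite exchange_big.
rewrite addrK -(der_sum (dder j)) /cov2 RicE; congr (_ - _ - _).
  by rewrite exchange_big; apply: eq_bigr => p _ /=; rewrite RicE mulr_sumr.
by rewrite exchange_big; apply: eq_bigr => p _ /=; rewrite RicE mulr_sumr.
Qed.

(** The other two terms of [bianchi] contract to derivatives of the Ricci tensor,
    with opposite signs. *)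
Lemma bianchi_trace i j l :
  \sum_m cov_Riem m m i j l = cov2 i Ric j l - cov2 j Ric i l.
Proof.
rewrite -!trace_cov_Riem -sumrB; apply: eq_bigr => m _.
by rewrite -[RHS]addr0 -(bianchi m i j m l) (cov_RiemN i m m j); ring.
Qed.

(** The remaining divergence nabla_m R^m_{ijl}, contracted over j and l, is a divergence
    of the Ricci tensor too, because g^{jl} R^m_{ijl} is R_i^m ([tr_Riem]). *)
Lemma tr_trace_cov_Riem i :
  tr (fun j l => \sum_m cov_Riem m m i j l) = tr (fun m k => cov2 m Ric i k).
Proof.
pose Y m i := tr (Riem m i).
have YE m a : Y m a = \sum_k Gi m k * Ric a k by exact: tr_Riem.
have -> : tr (fun m k => cov2 m Ric i k) =
    tr (fun m k => cov1 m (Ric i) k) - tr (fun m k => \sum_p Gamma p m i * Ric p k).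
  by rewrite -trB; apply: eq_tr => m k; rewrite /cov2 /cov1; ring.
have -> : tr (fun m k => \sum_p Gamma p m i * Ric p k) =
    \sum_m \sum_p Gamma p m i * Y m p.
  rewrite /tr; apply: eq_bigr => m _; under eq_bigr do rewrite mulr_sumr.
  rewrite exchange_big; apply: eq_bigr => p _; rewrite YE mulr_sumr.
  by apply: eq_bigr => k _; ring.
rewrite (tr_sum (fun m => cov_Riem m m i)) tr_cov1 -sumrB; apply: eq_bigr => m _.
have -> : tr (cov_Riem m m i) = tr (fun j l => cov2 m (Riem m i) j l
    + (\sum_p Gamma m m p * Riem p i j l - \sum_p Gamma p m i * Riem m p j l)).
  by apply: eq_tr => j l; rewrite /cov_Riem /cov2; ring.
rewrite trD tr_cov2 -/(Y m i) [X in _ + X = _]trB !tr_sum YE -addrA; congr (_ + (_ - _)).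
  by apply: eq_bigr => p _; rewrite trZ -/(Y p i) YE.
by apply: eq_bigr => p _; rewrite trZ -/(Y m p).
Qed.

(** The contracted Bianchi identity: both traces of the Bianchi identity produce
    the divergence of the Ricci tensor. *)
Lemma d_Scal i :
  d i Scal = tr (fun j l => cov2 j Ric i l) + tr (fun j l => cov2 j Ric i l).
Proof.
have : tr (fun j l => \sum_m cov_Riem m m i j l) =
       d i Scal - tr (fun j l => cov2 j Ric i l).
  by rewrite -tr_cov2 -trB; apply: eq_tr => j l; rewrite bianchi_trace.
by rewrite tr_trace_cov_Riem => {1}->; rewrite subrK.
Qed.

Context (D : A -> A) (Dder : derivation D).
Context (Dd : forall i a, D (d i a) = d i (D a)).

Let C k i j := D (Gamma k i j).
Let h i j := D (G i j).

Let hsym i j : h i j = h j i. Proof. by rewrite /h Gsym. Qed.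

(** Differentiating the defining relation of Gamma produces the partial derivatives
    of h and a term h Gamma; the latter is exactly what makes the partial derivatives
    covariant.  In particular the variation of the connection is a tensor. *)
Lemma D_Gamma_low m i j :
  \sum_p G m p * C p i j =
  half * (cov2 i h j m + cov2 j h i m - cov2 m h i j).
Proof.
have := congr1 D (Gamma_low m i j); rewrite (derM Dder) (der_half Dder half2) mul0r add0r.
rewrite (derB Dder) (derD Dder) !Dd -/(h _ _) -/(h _ _) -/(h _ _) (der_sum Dder).
under eq_bigr do rewrite (derM Dder) addrC.
rewrite big_split /= => E.
apply: (addIr (\sum_p h m p * Gamma p i j)); rewrite E {E}.
rewrite /cov2.
have S1 a b c : \sum_p Gamma p a b * h c p = \sum_p Gamma p a b * h p c.
  by apply: eq_bigr => p _; rewrite hsym.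
have S2 a b c : \sum_p Gamma p a b * h p c = \sum_p Gamma p b a * h p c.
  by apply: eq_bigr => p _; rewrite Gamma_sym.
have -> : \sum_p h m p * Gamma p i j = \sum_p Gamma p i j * h p m.
  by apply: eq_bigr => p _; rewrite hsym mulrC.
rewrite !S1 (S2 j i) (S2 m i) (S2 m j).
set s := \sum_p Gamma p i j * h p m.
rewrite -[X in _ = _ + X]mul1r -half2; ring.
Qed.

(** nabla_k C^m_{ij}, where C is the variation of the connection. *)
Definition covC k m i j := d k (C m i j) + \sum_p Gamma m k p * C p i j
  - \sum_p Gamma p k i * C m p j - \sum_p Gamma p k j * C m i p.

(** The Palatini identity. *)
Lemma D_Riem k i j l : D (Riem k i j l) = covC i k j l - covC j k i l.
Proof.
rewrite /Riem (derB Dder) (derD Dder) (derB Dder) !Dd !(der_sum Dder).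
have DS a b : \sum_p D (Gamma k a p * Gamma p b l) =
    \sum_p Gamma p b l * C k a p + \sum_p Gamma k a p * C p b l.
  rewrite -big_split; apply: eq_bigr => p _ /=.
  by rewrite (derM Dder) mulrC.
rewrite !DS /covC.
have -> : \sum_p Gamma p i j * C k p l = \sum_p Gamma p j i * C k p l.
  by apply: eq_bigr => p _; rewrite Gamma_sym.
rewrite -/(C k j l) -/(C k i l); ring.
Qed.

(** The one-form nabla^l T_{kl} - nabla_k (tr T), whose divergence carries the second
    order part of the variation of the scalar curvature. *)
Definition div_sub_dtr T k := tr (fun j l => cov2 l T k j - cov2 k T j l).

Lemma tr_flip T : tr (fun i j => T j i) = tr T.
Proof.
rewrite /tr exchange_big; apply: eq_bigr => i _; apply: eq_bigr => j _ /=.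
by rewrite Gisym.
Qed.

(** The vector field in the Palatini identity, with its index lowered. *)
Lemma div_sub_dtr_D k :
  div_sub_dtr h k = tr (fun j l => \sum_p G k p * C p j l) - \sum_m C m m k.
Proof.
have hs a b c : cov2 a h b c = cov2 a h c b.
  rewrite /cov2 hsym addrAC; congr (_ - _ - _); apply: eq_bigr => p _.
    by rewrite hsym.
  by rewrite hsym.
have -> : \sum_m C m m k = half * tr (fun j l => cov2 k h j l).
  transitivity (tr (fun j l => \sum_p G l p * C p j k)).
    rewrite /tr; apply: eq_bigr => m _.
    by rewrite GiGK.
  rewrite -trZ; transitivity (tr (fun j l => half * cov2 k h j l
      + (half * cov2 j h k l - half * cov2 l h j k))).
    by apply: eq_tr => j l; rewrite D_Gamma_low; ring.
  rewrite trD trB -[X in _ + (_ - X)]tr_flip.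
  rewrite (_ : tr (fun i j => half * cov2 i h j k) = tr (fun j l => half * cov2 j h k l)).
    by rewrite subrr addr0.
  by apply: eq_tr => i j; rewrite hs.
pose u := tr (fun j l => cov2 l h j k); pose v := tr (fun j l => cov2 k h j l).
have -> : div_sub_dtr h k = u - v.
  by rewrite -trB; apply: eq_tr => j l; rewrite hs.
have -> : tr (fun j l => \sum_p G k p * C p j l) = half * u + half * u - half * v.
  have -> : half * u + half * u = half * tr (fun j l => cov2 j h l k) + half * u.
    by rewrite -[tr (fun j l => cov2 j h l k)]tr_flip.
  rewrite -!trZ -trD -trB; apply: eq_tr => j l.
  by rewrite D_Gamma_low; ring.
by rewrite -/v -[in LHS](mul1r u) -[in LHS](mul1r v) -half2; ring.
Qed.

(** The trace of the Palatini identity is a divergence; the other term is the variation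
    of the inverse metric. *)
Lemma D_Scal :
  D Scal = tr (fun i k => cov1 i (div_sub_dtr h) k)
    - \sum_j \sum_l \sum_p \sum_q Gi j p * h p q * Gi q l * Ric j l.
Proof.
have -> : D Scal = tr (fun j l => D (Ric j l)) + \sum_j \sum_l D (Gi j l) * Ric j l.
  rewrite /Scal /tr (der_sum Dder) -big_split; apply: eq_bigr => j _ /=.
  rewrite (der_sum Dder) -big_split; apply: eq_bigr => l _ /=.
  by rewrite (derM Dder) addrC.
congr (_ + _); last first.
  rewrite -sumrN; apply: eq_bigr => j _; rewrite -sumrN; apply: eq_bigr => l _.
  rewrite (der_inv_metric _ _ Dder) mulNr; congr (- _); rewrite mulr_suml.
  by apply: eq_bigr => p _; rewrite mulr_suml.
pose X k := tr (fun j l => \sum_p G k p * C p j l).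
pose c k := \sum_m C m m k.
have trC p : tr (C p) = \sum_k Gi p k * X k.
  rewrite -[LHS](GiGK (fun q => tr (C q))); apply: eq_bigr => k _.
  by rewrite /X tr_sum; congr (_ * _); apply: eq_bigr => q _; rewrite trZ.
have trcovC i : tr (covC i i) = d i (tr (C i)) + \sum_p Gamma i i p * tr (C p).
  rewrite -tr_cov2 (eq_tr (U := fun j l => cov2 i (C i) j l + \sum_p Gamma i i p * C p j l)).
    by rewrite trD tr_sum; congr (_ + _); apply: eq_bigr => p _; rewrite trZ.
  by move=> j l; rewrite /covC /cov2; ring.
have sumcovC j l : \sum_m covC j m m l = cov1 j c l.
  rewrite /covC !sumrB big_split /=.
  rewrite (_ : \sum_m \sum_p Gamma m j p * C p m l =
               \sum_m \sum_p Gamma p j m * C m p l); last by rewrite exchange_big.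
  rewrite addrK -(der_sum (dder j)); congr (_ - _).
  by rewrite exchange_big; apply: eq_bigr => p _ /=; rewrite mulr_sumr.
rewrite (eq_tr (U := fun j l => \sum_i covC i i j l - cov1 j c l)); last first.
  move=> j l; rewrite RicE (der_sum Dder) -sumcovC -sumrB.
  by apply: eq_bigr => i _; rewrite D_Riem.
rewrite trB tr_sum.
have -> : \sum_i tr (covC i i) = tr (fun i k => cov1 i X k).
  rewrite tr_cov1; apply: eq_bigr => i _; rewrite trcovC trC; congr (_ + _).
  by apply: eq_bigr => p _; rewrite trC.
rewrite -trB; apply: eq_tr => i k.
rewrite /cov1 div_sub_dtr_D (derB (dder i)) -/(X k) -/(c k).
rewrite [in RHS](eq_bigr (fun p => Gamma p i k * X p - Gamma p i k * c p)); last first.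
  by move=> p _; rewrite div_sub_dtr_D mulrBr.
by rewrite sumrB; ring.
Qed.

(** The inner contraction commutes with the outer covariant derivative ([tr_cov3]), so
    both can be taken at the end, as in the evolution equation. *)
Lemma ddiv_sub_lap_trE S :
  tr (fun i k => cov1 i (div_sub_dtr S) k) =
  \sum_j \sum_l \sum_i \sum_k Gi j l * Gi i k *
    (cov3 i (fun l k j => cov2 l S k j) l k j - cov3 i (fun k j l => cov2 k S j l) k j l).
Proof.
pose W k j l := cov2 l S k j - cov2 k S j l.
transitivity (tr (fun i k => tr (cov3 i W k))).
  by apply: eq_tr => i k; rewrite (tr_cov3 i k W).
transitivity (\sum_i \sum_k \sum_j \sum_l Gi j l * Gi i k * cov3 i W k j l).
  rewrite /tr; apply: eq_bigr => i _; apply: eq_bigr => k _.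
  rewrite mulr_sumr; apply: eq_bigr => j _; rewrite mulr_sumr.
  by apply: eq_bigr => l _; rewrite mulrA (mulrC (Gi i k)).
transitivity (\sum_j \sum_l \sum_i \sum_k Gi j l * Gi i k * cov3 i W k j l).
  under eq_bigr do rewrite exchange_big; rewrite exchange_big; apply: eq_bigr => j _.
  under eq_bigr do rewrite exchange_big; rewrite exchange_big; apply: eq_bigr => l _.
  by [].
apply: eq_bigr => j _; apply: eq_bigr => l _; apply: eq_bigr => i _.
apply: eq_bigr => k _; congr (_ * _).
have WS (F U U' : 'I_n -> A) : \sum_p F p * (U p - U' p) =
    \sum_p F p * U p - \sum_p F p * U' p.
  by rewrite -sumrB; apply: eq_bigr => p _; rewrite mulrBr.
by rewrite /cov3 /W !WS (derB (dder i)); ring.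
Qed.

Lemma div_sub_dtrD T U k :
  div_sub_dtr (fun i j => T i j + U i j) k = div_sub_dtr T k + div_sub_dtr U k.
Proof.
have cD a b c : cov2 a (fun i j => T i j + U i j) b c = cov2 a T b c + cov2 a U b c.
  rewrite /cov2 (derD (dder a)).
  have SD (F V V' : 'I_n -> A) : \sum_p F p * (V p + V' p) =
      \sum_p F p * V p + \sum_p F p * V' p.
    by rewrite -big_split; apply: eq_bigr => p _; rewrite mulrDr.
  by rewrite !SD; ring.
by rewrite /div_sub_dtr -trD; apply: eq_tr => j l; rewrite !cD; ring.
Qed.

Lemma div_sub_dtrZ c T k : (forall i, d i c = 0) ->
  div_sub_dtr (fun i j => c * T i j) k = c * div_sub_dtr T k.
Proof.
move=> dc.
have cZ a b e : cov2 a (fun i j => c * T i j) b e = c * cov2 a T b e.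
  rewrite /cov2 (derM (dder a)) dc mul0r add0r !mulrBr !mulr_sumr.
  by congr (_ - _ - _); apply: eq_bigr => p _; ring.
by rewrite /div_sub_dtr -trZ; apply: eq_tr => j l; rewrite !cZ; ring.
Qed.

Definition lap f := tr (fun i k => cov1 i (fun k => d k f) k).

(** nabla^k nabla^l T_{kl} minus the Laplacian of the trace of T. *)
Definition ddiv_sub_lap_tr S := tr (fun i k => cov1 i (div_sub_dtr S) k).

Lemma ddiv_sub_lap_trD T U :
  ddiv_sub_lap_tr (fun i j => T i j + U i j) = ddiv_sub_lap_tr T + ddiv_sub_lap_tr U.
Proof.
rewrite /ddiv_sub_lap_tr -trD; apply: eq_tr => i k; rewrite /cov1 div_sub_dtrD (derD (dder i)).
under eq_bigr do rewrite div_sub_dtrD mulrDr.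
by rewrite big_split /=; ring.
Qed.

Lemma ddiv_sub_lap_trZ c T : (forall i, d i c = 0) ->
  ddiv_sub_lap_tr (fun i j => c * T i j) = c * ddiv_sub_lap_tr T.
Proof.
move=> dc; rewrite /ddiv_sub_lap_tr -trZ; apply: eq_tr => i k.
rewrite /cov1 div_sub_dtrZ // (derM (dder i)) dc mul0r add0r mulrBr mulr_sumr.
by congr (_ - _); apply: eq_bigr => p _; rewrite div_sub_dtrZ //; ring.
Qed.

(** nabla^l R_{kl} = nabla_k R / 2 makes the one-form of -2 Ric equal to
    - nabla_k R + 2 nabla_k R. *)
Lemma ddiv_sub_lap_tr_Ric :
  ddiv_sub_lap_tr (fun i j => - (Ric i j + Ric i j)) = lap Scal.
Proof.
apply: eq_tr => i k.
have VE a : div_sub_dtr (fun i j => - (Ric i j + Ric i j)) a = d a Scal.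
  transitivity (div_sub_dtr (fun i j => -2%:R * Ric i j) a).
    by congr (div_sub_dtr _ a); apply/funext => u; apply/funext => v; ring.
  rewrite div_sub_dtrZ; last by move=> u; rewrite (derN (dder u)) (der_nat (dder u)) oppr0.
  rewrite /div_sub_dtr trB tr_cov2 -/Scal.
  have -> : tr (fun j l => cov2 l Ric a j) = tr (fun j l => cov2 j Ric a l).
    by rewrite -tr_flip.
  by rewrite [in LHS](d_Scal a) [RHS](d_Scal a); ring.
by rewrite /cov1 VE; congr (_ - _); apply: eq_bigr => p _; rewrite VE.
Qed.

(** The divergence in [D_Scal] is linear in h, and the algebraic term turns into
    2 |Ric|^2 minus the contraction of S with Ric. *)
Lemma D_Scal_flow S : (forall i j, D (G i j) = - (Ric i j + Ric i j) + S i j) ->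
  D Scal = lap Scal
    + 2%:R * (\sum_i \sum_p \sum_k \sum_q Gi i p * Gi k q * Ric i k * Ric p q)
    + ddiv_sub_lap_tr S
    - \sum_i \sum_p \sum_k Gi i p * Ric i k * \sum_q Gi k q * S p q.
Proof.
move=> hS; rewrite D_Scal.
have -> : tr (fun i k => cov1 i (div_sub_dtr h) k) = lap Scal + ddiv_sub_lap_tr S.
  rewrite -ddiv_sub_lap_tr_Ric -ddiv_sub_lap_trD; apply: eq_tr => i k; congr (cov1 i _ k).
  apply/funext => a; congr (div_sub_dtr _ a).
  by apply/funext => u; apply/funext => v; exact: hS.
rewrite -!addrA; congr (_ + _); rewrite [RHS]addrCA; congr (_ + _).
rewrite mulr_sumr -sumrB -sumrN; apply: eq_bigr => i _.
rewrite exchange_big mulr_sumr -sumrB -sumrN; apply: eq_bigr => p _ /=.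
rewrite mulr_sumr -sumrB -sumrN; apply: eq_bigr => k _.
rewrite [X in _ = X - _]mulr_sumr [X in _ = _ - X]mulr_sumr -sumrB -sumrN.
apply: eq_bigr => q _.
by rewrite /h hS (Gisym q k); ring.
Qed.

End Riemann.

(** * Time derivatives relative to an interval *)

Section TimeDerivative.
Context {R : realType} (J : set R).
Implicit Types (f g : R -> R) (t l : R).

Lemma near_within_dnbhs t (P : R -> Prop) :
  (forall s, J s -> s != t -> P s) -> \forall s \near within J t^', P s.
Proof.
by move=> H; rewrite near_withinE; apply: filterS (nbhs_dnbhs_neq t) => s st Js; apply: H.
Qed.

Lemma eq_has_dt f g t l : J t -> (forall s, J s -> f s = g s) ->
  has_dt J f t l -> has_dt J g t l.
Proof.
move=> Jt fg; apply: cvg_trans; apply: near_eq_cvg.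
by apply: near_within_dnbhs => s Js _; rewrite /time_quot !fg.
Qed.

Lemma cvg_within_id t : (fun s => s) @ within J t^' --> t.
Proof. by apply: cvg_within_filter; exact: cvg_within. Qed.

Lemma has_dt_cvg f t l : has_dt J f t l -> f @ within J t^' --> f t.
Proof.
move=> fl; have H : (fun s => f t + time_quot f t s * (s - t)) @ within J t^' --> f t + l * (t - t).
  apply: cvgD; first exact: cvg_cst.
  apply: cvgM => //; apply: cvgB; last exact: cvg_cst.
  exact: cvg_within_id.
rewrite subrr mulr0 addr0 in H; apply: cvg_trans H; apply: near_eq_cvg.
apply: near_within_dnbhs => s _ st; rewrite /time_quot -mulrA mulVf ?subr_eq0 //.
by rewrite mulr1 addrC subrK.
Qed.

Lemma has_dt_cst c t : has_dt J (fun=> c) t 0.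
Proof.
have : (fun=> 0 : R) @ within J t^' --> (0 : R) by exact: cvg_cst.
apply: cvg_trans; apply: near_eq_cvg.
by apply: near_within_dnbhs => s _ _; rewrite /time_quot subrr mul0r.
Qed.

Lemma has_dtD f g t l m : has_dt J f t l -> has_dt J g t m ->
  has_dt J (fun s => f s + g s) t (l + m).
Proof.
move=> fl gm; apply: cvg_trans (cvgD fl gm); apply: near_eq_cvg.
apply: near_within_dnbhs => s _ _; rewrite /time_quot !fctE /=; ring.
Qed.

Lemma has_dtM f g t l m : has_dt J f t l -> has_dt J g t m ->
  has_dt J (fun s => f s * g s) t (l * g t + f t * m).
Proof.
move=> fl gm.
apply: cvg_trans (cvgD (cvgM fl (has_dt_cvg gm)) (cvgM (cvg_cst (f t)) gm)).
apply: near_eq_cvg.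
apply: near_within_dnbhs => s _ _; rewrite /time_quot !fctE /=; ring.
Qed.

Lemma has_dtV f t l : f t != 0 -> has_dt J f t l ->
  has_dt J (fun s => (f s)^-1) t (- l * (f t)^-1 * (f t)^-1).
Proof.
move=> ft0 fl; have fc := has_dt_cvg fl.
apply: cvg_trans (cvgM (cvgM (cvgN fl) (cvgV ft0 fc)) (cvg_cst (f t)^-1)).
apply: near_eq_cvg; near=> s; rewrite /time_quot !fctE /=.
have fs0 : f s != 0.
  near: s; have : \forall y \near f t, y != 0.
    exact: (open_nbhs_nbhs (conj (@open_neq R 0) ft0)).
  by move/fc.
have st0 : s - t != 0.
  by rewrite subr_eq0; near: s; apply: near_within_dnbhs.
by field; apply/and3P.
Unshelve. all: by end_near. Qed.

Context (J_itv : is_interval J) (J_int : J° !=set0).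

(** Every point of a nondegenerate interval is a limit of other points of it, so the
    relative derivative is unique, also at an end of the interval. *)
Lemma within_dnbhs_proper t : J t -> ProperFilter (within J t^').
Proof.
move=> Jt; apply: Build_ProperFilter_ex => P.
rewrite /within /= => /nbhs_ballP[e /= e0 H].
have [y Jy yt] : exists2 y, J y & y != t.
  have [y /nbhs_ballP[r /= r0 yr]] := J_int.
  have [->|] := eqVneq t y; last by exists y; [apply: yr; exact: ballxx | rewrite eq_sym].
  exists (y + r / 2); first by apply: yr; rewrite /ball /= opprD addNKr normrN gtr0_norm; lra.
  by rewrite -subr_eq0 addrAC subrr add0r; apply: lt0r_neq0; lra.
suff [s [Js st ss]] : exists s, [/\ J s, s != t & `|t - s| < e].
  by exists s; apply: H.
move: yt; rewrite neq_lt => /orP[yt|yt].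
  have ht : t - e / 2 < t by lra.
  exists (Num.max y (t - e / 2)); split.
  - by apply: (J_itv Jy Jt); rewrite le_max lexx /= ge_max (ltW yt) (ltW ht).
  - by rewrite lt_eqF // gt_max yt.
  - rewrite ger0_norm; last by rewrite subr_ge0 ge_max !ltW.
    by rewrite ltrBlDr -ltrBlDl lt_max; apply/orP; right; lra.
have ht : t < t + e / 2 by lra.
exists (Num.min y (t + e / 2)); split.
- by apply: (J_itv Jt Jy); rewrite ge_min lexx /= le_min (ltW yt) (ltW ht).
- by rewrite gt_eqF // lt_min yt.
- rewrite distrC ger0_norm; last by rewrite subr_ge0 le_min !ltW.
  by rewrite ltrBlDr gt_min; apply/orP; right; lra.
Qed.

Lemma has_dt_dt f t l : J t -> has_dt J f t l -> dt J f t = l.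
Proof.
move=> Jt fl; have := within_dnbhs_proper Jt => FF.
by apply: cvg_lim => //; exact: norm_hausdorff.
Qed.

End TimeDerivative.

(** * Closure properties of smoothness *)

Section Smooth.
Context {R : realType} {n : nat} (J : set R) (V : set 'rV[R]_n).
Context (J_itv : is_interval J) (J_int : J° !=set0) (V_open : open V).
Implicit Types (f g : R -> 'rV[R]_n -> R) (a : option 'I_n).

Definition eqon f g := forall t x, J t -> V x -> f t x = g t x.

(** The condition imposed on each iterated derivative in [st_smooth_on]. *)
Definition C1 f : Prop :=
  {within J `*` V, continuous (fun z : R * 'rV[R]_n => f z.1 z.2)} /\
  forall t x, J t -> V x ->
    cvg (time_quot (f ^~ x) t u @[u --> within J t^']) /\
    forall i, derivable (f t) x (delta_mx 0 i).

(** Recursion on the derivatives of f, so that closure under products and inverses is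
    a plain induction; [Ck 0] is already [C1], so the order is k + 1. *)
Fixpoint Ck k f : Prop :=
  C1 f /\ if k is k'.+1 then forall a, Ck k' (stpd J a f) else True.

Lemma st_smooth_onP f : st_smooth_on J V f <-> forall k, Ck k f.
Proof.
split=> [fs k|fk s].
  elim: k f fs => [|k IH] f fs; split=> //; try exact: (fs [::]).
  by move=> a; apply: IH => s; have := fs (rcons s a); rewrite -cats1 foldr_cat.
elim/last_ind: s f fk => [|s a IH] f fk; first by case: (fk 0).
by rewrite -cats1 foldr_cat; apply: IH => k; case: (fk k.+1) => _; exact.
Qed.

Lemma st_smooth_stpd a f : st_smooth_on J V f -> st_smooth_on J V (stpd J a f).
Proof. by move=> /st_smooth_onP fk; apply/st_smooth_onP => k; case: (fk k.+1) => _; exact. Qed.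

Lemma near_V x : V x -> \forall y \near x, V y.
Proof. by move=> Vx; exact: open_nbhs_nbhs. Qed.

Lemma eqon_C1 f g : eqon f g -> C1 f -> C1 g.
Proof.
move=> fg [cf df]; split.
  apply: subspace_eq_continuous cf => z /[!inE] -[/= Jz Vz].
  exact: fg.
move=> t x Jt Vx; have [ct dfi] := df t x Jt Vx; split.
  move/cvg_ex: ct => [l fl]; apply/cvg_ex; exists l.
  by apply: (eq_has_dt Jt _ fl) => s Js; rewrite fg.
move=> i; apply: near_eq_derivable (dfi i).
by apply: filterS (near_V Vx) => y Vy; rewrite fg.
Qed.

Lemma eqon_stpd a f g : eqon f g -> eqon (stpd J a f) (stpd J a g).
Proof.
move=> fg t x Jt Vx; case: a => [i|] /=.
  by apply: near_eq_derive; apply: filterS (near_V Vx) => y Vy; rewrite fg.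
rewrite /dt; congr (lim _); rewrite eqEsubset; split; apply: near_eq_cvg;
by apply: near_within_dnbhs => s Js _; rewrite /time_quot !fg.
Qed.

Lemma eqon_Ck k f g : eqon f g -> Ck k f -> Ck k g.
Proof.
elim: k f g => [|k IH] f g fg [f1 fk]; split=> //; try exact: eqon_C1 f1.
by move=> a; apply: IH (fk a); exact: eqon_stpd.
Qed.

Lemma CkW k f : Ck k.+1 f -> Ck k f.
Proof.
elim: k f => [|k IH] f [f1 fk]; split=> // a.
by apply: IH; exact: fk.
Qed.

Lemma C1_has_dt f t x : C1 f -> J t -> V x ->
  has_dt J (f ^~ x) t (stpd J None f t x).
Proof. by move=> [_ H] Jt Vx; have [] := H t x Jt Vx. Qed.

Lemma C1_derivable f t x i : C1 f -> J t -> V x -> derivable (f t) x (delta_mx 0 i).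
Proof. by move=> [_ H] Jt Vx; have [] := H t x Jt Vx. Qed.

Lemma C1_cvg f t x : C1 f -> J t -> V x ->
  f z.1 z.2 @[z --> within (J `*` V) (nbhs (t, x))] --> f t x.
Proof. by move=> [/subspace_continuousP H _] Jt Vx; apply: (H (t, x)). Qed.

Lemma C1_cst c : C1 (fun _ _ => c).
Proof.
split; first by apply: continuous_subspaceT => z; exact: cvg_cst.
move=> t x Jt Vx; split=> [|i]; last exact: derivable_cst.
by apply/cvg_ex; exists 0; exact: has_dt_cst.
Qed.

Lemma C1D f g : C1 f -> C1 g -> C1 (fun t x => f t x + g t x).
Proof.
move=> f1 g1; split.
  apply/subspace_continuousP => -[t x] [/= Jt Vx].
  by apply: cvgD; exact: C1_cvg.
move=> t x Jt Vx; split=> [|i].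
  by apply/cvg_ex; eexists; apply: has_dtD; exact: C1_has_dt.
by apply: derivableD; exact: C1_derivable.
Qed.

Lemma C1M f g : C1 f -> C1 g -> C1 (fun t x => f t x * g t x).
Proof.
move=> f1 g1; split.
  apply/subspace_continuousP => -[t x] [/= Jt Vx].
  by apply: cvgM; exact: C1_cvg.
move=> t x Jt Vx; split=> [|i].
  by apply/cvg_ex; eexists; apply: has_dtM; exact: C1_has_dt.
by apply: derivableM; exact: C1_derivable.
Qed.

Lemma C1V f : (forall t x, J t -> V x -> f t x != 0) -> C1 f ->
  C1 (fun t x => (f t x)^-1).
Proof.
move=> f0 f1; split.
  apply/subspace_continuousP => -[t x] [/= Jt Vx].
  by apply: cvgV; [exact: f0 | exact: C1_cvg].
move=> t x Jt Vx; split=> [|i].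
  by apply/cvg_ex; eexists; apply: has_dtV; [exact: f0 | exact: C1_has_dt].
by apply: derivableV; [exact: f0 | exact: C1_derivable].
Qed.

Lemma stpd_cst a c : eqon (stpd J a (fun _ _ => c)) (fun _ _ => 0).
Proof.
move=> t x Jt Vx; case: a => [i|] /=; first exact: derive_cst.
by apply: has_dt_dt => //; exact: has_dt_cst.
Qed.

Lemma stpdD a f g : C1 f -> C1 g -> eqon (stpd J a (fun t x => f t x + g t x))
  (fun t x => stpd J a f t x + stpd J a g t x).
Proof.
move=> f1 g1 t x Jt Vx; case: a => [i|] /=.
  by rewrite /pd deriveD //; exact: C1_derivable.
by apply: has_dt_dt => //; apply: has_dtD; exact: C1_has_dt.
Qed.

Lemma stpdM a f g : C1 f -> C1 g -> eqon (stpd J a (fun t x => f t x * g t x))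
  (fun t x => stpd J a f t x * g t x + f t x * stpd J a g t x).
Proof.
move=> f1 g1 t x Jt Vx; case: a => [i|] /=.
  rewrite /pd deriveM; try exact: C1_derivable.
  by rewrite addrC; congr (_ + _); rewrite mulrC.
by apply: has_dt_dt => //; apply: has_dtM; exact: C1_has_dt.
Qed.

Lemma stpdV a f : (forall t x, J t -> V x -> f t x != 0) -> C1 f ->
  eqon (stpd J a (fun t x => (f t x)^-1))
    (fun t x => (-1 * stpd J a f t x) * (f t x)^-1 * (f t x)^-1).
Proof.
move=> f0 f1 t x Jt Vx; rewrite mulN1r; case: a => [i|] /=.
  rewrite /pd deriveV; [|exact: f0|exact: C1_derivable].
  by rewrite /GRing.scale /= -exprVn expr2; ring.
by apply: has_dt_dt => //; apply: has_dtV; [exact: f0|exact: C1_has_dt].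
Qed.

Lemma Ck_cst k c : Ck k (fun _ _ => c).
Proof.
elim: k c => [|k IH] c; split=> //; try exact: C1_cst.
move=> a; apply: (@eqon_Ck k (fun _ _ => 0)); last exact: IH.
by move=> t x Jt Vx; rewrite stpd_cst.
Qed.

Lemma CkD k f g : Ck k f -> Ck k g -> Ck k (fun t x => f t x + g t x).
Proof.
elim: k f g => [|k IH] f g [f1 fk] [g1 gk]; split=> //; try exact: C1D.
move=> a; apply: eqon_Ck (IH _ _ (fk a) (gk a)) => t x Jt Vx.
by rewrite stpdD.
Qed.

Lemma CkM k f g : Ck k f -> Ck k g -> Ck k (fun t x => f t x * g t x).
Proof.
elim: k f g => [|k IH] f g [f1 fk] [g1 gk]; split=> //; try exact: C1M.
have fk' : Ck k f by apply: CkW.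
have gk' : Ck k g by apply: CkW.
move=> a; apply: eqon_Ck (CkD (IH _ _ (fk a) gk') (IH _ _ fk' (gk a))) => t x Jt Vx.
by rewrite stpdM.
Qed.

(** The derivative of 1/f is a product of the derivative of f and two factors 1/f, so each
    order of regularity of 1/f yields the next one. *)
Lemma CkV k f : (forall t x, J t -> V x -> f t x != 0) -> Ck k f ->
  Ck k (fun t x => (f t x)^-1).
Proof.
move=> f0; elim: k => [|k IH] [f1 fk]; split=> //; try exact: C1V.
have fV : Ck k (fun t x => (f t x)^-1) by apply/IH/CkW.
move=> a; apply: eqon_Ck (CkM (CkM (CkM (@Ck_cst k (-1)) (fk a)) fV) fV) => t x Jt Vx.
by rewrite stpdV.
Qed.

End Smooth.

(** * Commutation of partial derivatives *)

Section Clairaut.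
Context {R : realType}.

(** At an interior point the relative derivative is the ordinary one; with the converse
    below this gives access to the mean value theorem and lets one treat a space
    variable as a time. *)
Lemma is_derive_has_dt (J : set R) (f : R -> R) (t l : R) :
  is_derive t 1 f l -> has_dt J f t l.
Proof.
move=> /is_derive1_caratheodory[g [fg gc <-]].
have : g @ within J t^' --> g t.
  by apply: cvg_trans gc; exact: (cvg_app g (@cvg_within_id _ J t)).
apply: cvg_trans; apply: near_eq_cvg; apply: near_within_dnbhs => s _ st.
by rewrite /time_quot fg mulfK // subr_eq0.
Qed.

Lemma has_dt_is_derive (J : set R) (f : R -> R) (t l : R) :
  nbhs t J -> has_dt J f t l -> is_derive t 1 f l.
Proof.
move=> tJ fl; apply/is_derive1_caratheodory.
exists (fun s => if s == t then l else time_quot f t s); split; last by rewrite eqxx.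
  move=> s; case: eqP => [->|/eqP st]; first by rewrite !subrr mulr0.
  by rewrite /time_quot divfK // subr_eq0.
apply/continuous_withinNx; rewrite eqxx => P /fl; rewrite /fmap /within /= => H.
rewrite near_simpl; apply: filterS3 (nbhs_dnbhs_neq t) (nbhs_dnbhs tJ) H => s st Js /(_ Js).
by rewrite /= (negPf st).
Qed.

Context (J : set R) (J_itv : is_interval J).

(** Interior points of the segment are interior to J, and at the two ends
    continuity relative to J suffices. *)
Lemma MVT_dt f df s t : J s -> J t ->
  (forall u, J u -> has_dt J f u (df u)) ->
  exists u, [/\ J u, `|u - t| <= `|s - t| & f s - f t = df u * (s - t)].
Proof.
have main a b : J a -> J b -> a <= b -> (forall u, J u -> has_dt J f u (df u)) ->
    exists u, [/\ J u, a <= u <= b & f b - f a = df u * (b - a)].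
  move=> Ja Jb ab fdf.
  have Jab u : a <= u <= b -> J u by apply: J_itv.
  have [||u] := @MVT_segment R f df a b ab.
  - move=> u; rewrite in_itv /= => /andP[au ub].
    apply: (@has_dt_is_derive J); last by apply/fdf/Jab; rewrite !ltW.
    have : nbhs u `]a, b[%classic.
      by apply: open_nbhs_nbhs; split; [exact: itv_open|rewrite /= in_itv /= au ub].
    apply: filterS => v; rewrite /= in_itv /= => /andP[av vb].
    by apply: Jab; rewrite !ltW.
  - apply/subspace_continuousP => u /=; rewrite in_itv /= => uab.
    have Ju := Jab _ uab.
    have fc : f @ within J u^' --> f u by exact: has_dt_cvg (fdf u Ju).
    move=> P /= nP; have /= := fc P nP.
    rewrite /fmap /within /= !near_simpl !near_withinE /= => H.
    apply: filterS H => v H vab; have [->|vu] := eqVneq v u.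
      exact: nbhs_singleton.
    by apply: H => //; apply: Jab; move: vab; rewrite in_itv.
  rewrite in_itv /= => uab E; exists u; split=> //.
  exact: Jab.
move=> Js Jt fdf; have [ts|/ltW st] := leP t s.
  have [u [Ju /andP[tu us] E]] := main t s Jt Js ts fdf.
  by exists u; split=> //; rewrite !ger0_norm ?subr_ge0 // lerB.
have [u [Ju /andP[su ut] E]] := main s t Js Jt st fdf.
exists u; split=> //; first by rewrite !ler0_norm ?subr_le0 // lerN2 lerB.
by rewrite -opprB E -mulrN opprB.
Qed.

End Clairaut.

Section Mixed.
Context {R : realType} (J : set R) (J_itv : is_interval J) (r : R) (r0 : 0 < r).
Context (p pt pv ptv : R -> R -> R).
Context (p_t : forall t v, J t -> `|v| < r -> has_dt J (p ^~ v) t (pt t v)).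
Context (p_v : forall t, J t -> is_derive (0 : R) (1 : R) (p t) (pv t 0)).
Context (pt_v : forall t v, J t -> `|v| < r -> is_derive v (1 : R) (pt t) (ptv t v)).

(** Two applications of the mean value theorem write the second difference of p over
    [t, s] and [0, h] as (s - t) h times a value of ptv at a point that tends to (t, 0).
    Letting h tend to 0 first, at fixed s, leaves a bound on the time quotient of pv. *)
Lemma mixed_derivative t : J t ->
  (forall e, 0 < e -> exists2 d, 0 < d & forall s v, J s -> `|s - t| < d -> `|v| < d ->
     `|ptv s v - ptv t 0| <= e) ->
  has_dt J (pv ^~ 0) t (ptv t 0).
Proof.
move=> Jt ptv_c; apply/cvgrPdist_le => e e0.
have [d d0 ptv_d] := ptv_c e e0.
rewrite near_withinE; apply: filterS2 (nbhs_dnbhs_neq t) (nbhs_dnbhs _); last first.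
  exact: (nbhsx_ballx t d d0).
move=> s st sd Js.
(* Q h is the normalized second difference. *)
pose Q h := ((p s h - p s 0) / (h - 0) - (p t h - p t 0) / (h - 0)) / (s - t).
have Qc : Q @ (0 : R)^' --> time_quot (pv ^~ 0) t s.
  have H u : J u -> (fun h => (p u h - p u 0) / (h - 0)) @ (0 : R)^' --> pv u 0.
    move=> Ju; have := is_derive_has_dt setT (p_v Ju).
    rewrite /has_dt /time_quot (_ : within setT (0 : R)^' = (0 : R)^') //.
    by rewrite eqEsubset; split=> P; rewrite /within /=; apply: filterS => h; exact.
  by apply: cvgM; [apply: cvgB; exact: H | exact: cvg_cst].
have Qd : (fun h => `|ptv t 0 - Q h|) @ (0 : R)^' --> `|ptv t 0 - time_quot (pv ^~ 0) t s|.
  by apply: cvg_norm; apply: cvgB; [exact: cvg_cst | exact: Qc].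
apply: (closed_cvg (fun x => x <= e)) Qd; first exact: closed_le.
have m0 : 0 < Num.min r d by rewrite lt_min r0 d0.
apply: filterS2 (nbhs_dnbhs_neq (0 : R)) (nbhs_dnbhs (nbhsx_ballx (0 : R) _ m0)).
move=> h h0; rewrite /ball /= sub0r normrN lt_min => /andP[hr hd].
have zr : `|0 : R| < r by rewrite normr0.
have [u [Ju us E]] := MVT_dt J_itv Js Jt (fun u Ju =>
  has_dtD (p_t Ju hr) (has_dtM (has_dt_cst J (-1) u) (p_t Ju zr))).
have [w [/= wr wh E']] : exists w, [/\ `|w| < r, `|w| <= `|h| &
    pt u h - pt u 0 = ptv u w * h].
  have I_abs v : `]-r, r[%classic v = (`|v| < r) by rewrite /= in_itv /= -ltr_norml.
  have Idt v : `]-r, r[%classic v -> has_dt `]-r, r[ (pt u) v (ptv u v).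
    by rewrite I_abs => vr; exact: is_derive_has_dt (pt_v Ju vr).
  have Ih : `]-r, r[%classic h by rewrite I_abs.
  have I0 : `]-r, r[%classic (0 : R) by rewrite I_abs.
  have [w [wI w1 w2]] := MVT_dt (@interval_is_interval R `]-r, r[) Ih I0 Idt.
  by exists w; move: wI w1 w2; rewrite !subr0 I_abs.
suff -> : Q h = ptv u w.
  rewrite distrC; apply: ptv_d => //; last exact: le_lt_trans wh hd.
  by apply: le_lt_trans us _; rewrite distrC.
have st0 : s - t != 0 by rewrite subr_eq0.
have -> : Q h = (p s h + -1 * p s 0 - (p t h + -1 * p t 0)) / (h * (s - t)).
  by rewrite /Q; field; rewrite h0 st0.
rewrite E mul0r add0r mulN1r E'; field.
by rewrite h0 st0.
Qed.

End Mixed.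

Section Commute.
Context {R : realType} {n : nat} (J : set R) (V : set 'rV[R]_n).
Context (J_itv : is_interval J) (J_int : J° !=set0) (V_open : open V).
Implicit Types (f h : R -> 'rV[R]_n -> R) (a b : option 'I_n).

Lemma is_derive_line (g : 'rV[R]_n -> R) (e x : 'rV[R]_n) (v : R) :
  derivable g (v *: e + x) e ->
  is_derive v (1 : R) (fun u : R => g (u *: e + x)) ('D_e g (v *: e + x)).
Proof.
have E : (fun k : R => k^-1 *: (((fun u : R => g (u *: e + x)) \o shift v) (k *: (1 : R)) -
    g (v *: e + x))) = (fun k => k^-1 *: ((g \o shift (v *: e + x)) (k *: e) - g (v *: e + x))).
  apply/funext => k /=; congr (_ *: (g _ - _)).
  by rewrite [k%:A]mulr1 scalerDl addrA.
by move=> dg; apply: DeriveDef; rewrite ?/derivable ?/derive E.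
Qed.

Lemma C1_cvg_param h t x (T : pseudoMetricType R) (g1 : T -> R) (g2 : T -> 'rV[R]_n) w :
  C1 J V h -> J t -> V x -> g1 @ w --> t -> g2 @ w --> x ->
  forall e : R, 0 < e -> exists2 d, 0 < d & forall z, ball w d z -> J (g1 z) -> V (g2 z) ->
    `|h (g1 z) (g2 z) - h t x| <= e.
Proof.
move=> h1 Jt Vx g1c g2c e e0.
have /cvgrPdist_le/(_ e e0) := C1_cvg h1 Jt Vx.
rewrite near_withinE => H.
have gc : (fun z => (g1 z, g2 z)) @ w --> (t, x) by exact: (cvg_pair g1c g2c).
have /nbhs_ballP[d d0 wd] := gc _ H.
exists d => // z zd Jz Vz; rewrite distrC.
by have /= := wd z zd; apply.
Qed.

Lemma near_line x (e : 'rV[R]_n) : V x ->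
  exists2 r, 0 < r & forall v, `|v| < r -> V (v *: e + x).
Proof.
move=> Vx; have c : (fun v : R => v *: e + x) @ (0 : R) --> x.
  rewrite -[X in _ --> X]add0r -(scale0r e); apply: cvgD; last exact: cvg_cst.
  by apply: cvgZr_tmp; exact: cvg_id.
have /nbhs_ballP[r r0 H] := c _ (near_V V_open Vx).
by exists r => // v vr; apply: H; rewrite /ball /= sub0r normrN.
Qed.

(** [mixed_derivative] along the line through x in the direction i. *)
Lemma stpdC_time i f : C1 J V f -> (forall a, C1 J V (stpd J a f)) ->
  (forall a b, C1 J V (stpd J a (stpd J b f))) ->
  eqon J V (stpd J None (stpd J (Some i) f)) (stpd J (Some i) (stpd J None f)).
Proof.
move=> f1 f2 f3 t x Jt Vx; set e := delta_mx 0 i : 'rV[R]_n.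
have [r r0 rV] := near_line e Vx.
rewrite [LHS](@has_dt_dt _ _ J_itv J_int _ _ (stpd J (Some i) (stpd J None f) t x)) //=.
pose p s (v : R) := f s (v *: e + x).
pose pt s (v : R) := stpd J None f s (v *: e + x).
pose pv s (v : R) := pd i (f s) (v *: e + x).
pose ptv s (v : R) := pd i (stpd J None f s) (v *: e + x).
suff : has_dt J (pv ^~ 0) t (ptv t 0).
  by rewrite /pv /ptv scale0r add0r.
apply: (@mixed_derivative R J J_itv r r0 p pt pv ptv _ _ _ t Jt).
- by move=> s v Js vr; exact: (C1_has_dt f1 Js (rV v vr)).
- move=> s Js; rewrite /pv /p; apply: is_derive_line.
  by rewrite scale0r add0r; exact: (C1_derivable f1 Js Vx).
- move=> s v Js vr; apply: is_derive_line; exact: (C1_derivable (f2 None) Js (rV v vr)).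
- move=> d d0.
  have c1 : (fun z : R * R => z.1) @ (t, 0 : R) --> t by exact: cvg_fst.
  have c2 : (fun z : R * R => z.2 *: e + x) @ (t, 0 : R) --> x.
    rewrite -[X in _ --> X]add0r -(scale0r e); apply: cvgD; last exact: cvg_cst.
    by apply: cvgZr_tmp; exact: cvg_snd.
  have [m m0 H] := C1_cvg_param (f3 (Some i) None) Jt Vx c1 c2 d0.
  exists (Num.min m r); first by rewrite lt_min m0 r0.
  move=> s v Js st vr; rewrite /ptv scale0r add0r; apply: (H (s, v)) => //.
    split; rewrite /ball /=; first by rewrite distrC (lt_le_trans st) // ge_min lexx.
    by rewrite sub0r normrN (lt_le_trans vr) // ge_min lexx.
  by apply: rV; rewrite (lt_le_trans vr) // ge_min lexx orbT.
Qed.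

(** [mixed_derivative] again, with the j-th coordinate in the role of time and a small
    open interval in the role of J. *)
Lemma stpdC_space i j f : C1 J V f -> (forall a, C1 J V (stpd J a f)) ->
  (forall a b, C1 J V (stpd J a (stpd J b f))) ->
  eqon J V (stpd J (Some j) (stpd J (Some i) f)) (stpd J (Some i) (stpd J (Some j) f)).
Proof.
move=> f1 f2 f3 t x Jt Vx.
set e := delta_mx 0 i : 'rV[R]_n; set e' := delta_mx 0 j : 'rV[R]_n.
have c2 : (fun z : R * R => z.2 *: e + (z.1 *: e' + x)) @ (0 : R, 0 : R) --> x.
  have -> : nbhs x = nbhs (0 *: e + (0 *: e' + x)) by rewrite !scale0r !add0r.
  apply: cvgD; first by apply: cvgZr_tmp; exact: cvg_snd.
  by apply: cvgD; [apply: cvgZr_tmp; exact: cvg_fst | exact: cvg_cst].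
have /nbhs_ballP[r /= r0 H0] := c2 _ (near_V V_open Vx).
have rV u v : `|u| < r -> `|v| < r -> V (v *: e + (u *: e' + x)).
  move=> ur vr; apply: (H0 (u, v)).
  by split; rewrite /ball /= sub0r normrN.
have z0 : `|0 : R| < r by rewrite normr0.
have I_abs v : `]-r, r[%classic v = (`|v| < r) by rewrite /= in_itv /= -ltr_norml.
pose p u (v : R) := f t (v *: e + (u *: e' + x)).
pose pu u (v : R) := pd j (f t) (v *: e + (u *: e' + x)).
pose pv u (v : R) := pd i (f t) (v *: e + (u *: e' + x)).
pose puv u (v : R) := pd i (pd j (f t)) (v *: e + (u *: e' + x)).
have I0 : `]-r, r[%classic (0 : R) by rewrite I_abs.
have : has_dt `]-r, r[ (pv ^~ 0) 0 (puv 0 0).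
  apply: (@mixed_derivative R `]-r, r[ (@interval_is_interval R `]-r, r[) r r0
    p pu pv puv _ _ _ 0 I0).
  - move=> u v; rewrite I_abs => ur vr; apply: is_derive_has_dt.
    have E w : v *: e + (w *: e' + x) = w *: e' + (v *: e + x) by rewrite addrCA.
    rewrite /p /pu; under eq_fun do rewrite E.
    rewrite E; apply: is_derive_line; rewrite -E.
    exact: (C1_derivable f1 Jt (rV u v ur vr)).
  - move=> u; rewrite I_abs => ur; apply: is_derive_line.
    exact: (C1_derivable f1 Jt (rV u 0 ur z0)).
  - move=> u v; rewrite I_abs => ur vr; apply: is_derive_line.
    exact: (C1_derivable (f2 (Some j)) Jt (rV u v ur vr)).
  - move=> d d0.
    have c1 : (fun z : R * R => t) @ (0 : R, 0 : R) --> t by exact: cvg_cst.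
    have [m m0 H] := C1_cvg_param (f3 (Some i) (Some j)) Jt Vx c1 c2 d0.
    exists (Num.min m r); first by rewrite lt_min m0 r0.
    move=> u v; rewrite I_abs subr0 /puv !scale0r !add0r => ur um vm.
    apply: (H (u, v)) => //=.
      split; rewrite /ball /= sub0r normrN; first by rewrite (lt_le_trans um) // ge_min lexx.
      by rewrite (lt_le_trans vm) // ge_min lexx.
    by apply: rV => //; rewrite (lt_le_trans vm) // ge_min lexx orbT.
move=> /has_dt_is_derive H.
have /H{H} : nbhs (0 : R) `]-r, r[%classic by apply: open_nbhs_nbhs; split; [exact: itv_open|].
rewrite /pv /puv !scale0r !add0r; under eq_fun do rewrite add0r.
move=> H; have := @is_derive_line (pd i (f t)) e' x 0; rewrite scale0r add0r.
move=> /(_ (C1_derivable (f2 (Some i)) Jt Vx)) H'.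
by rewrite /= -[LHS](@derive_val _ _ _ _ _ _ _ H') (@derive_val _ _ _ _ _ _ _ H).
Qed.

Lemma stpdC a b f : st_smooth_on J V f ->
  eqon J V (stpd J a (stpd J b f)) (stpd J b (stpd J a f)).
Proof.
move=> fs; have f1 : C1 J V f by exact: (fs [::]).
have f2 c : C1 J V (stpd J c f) by exact: (fs [:: c]).
have f3 c d : C1 J V (stpd J c (stpd J d f)) by exact: (fs [:: c; d]).
case: a b => [i|] [j|] t x Jt Vx.
- exact: stpdC_space.
- by rewrite -stpdC_time.
- exact: stpdC_time.
- reflexivity.
Qed.

End Commute.

(** * The ring of smooth functions on a space-time domain *)

(** A time interval and a coordinate domain.  Bundling their properties lets the
    ring structure below be inferred from the region alone. *)
Record region (R : realType) (n : nat) := Region {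
  times : set R;
  dom : set 'rV[R]_n;
  times_itv : is_interval times;
  times_int : times° !=set0;
  dom_open : open dom
}.

Arguments times_itv {R n} r.
Arguments times_int {R n} r.
Arguments dom_open {R n} r.

Section SmoothRing.
Context {R : realType} {n : nat} (W : region R n).
Notation J := (times W).
Notation V := (dom W).

(** Ring elements are functions on the points of the region only, so that two of them
    are equal as soon as they agree there; this is what makes the derivatives
    well-defined ring derivations. *)
Definition point := {z : R * 'rV[R]_n | J z.1 /\ V z.2}.

(** Extension by zero, since smoothness is stated for functions of a real
    and a vector. *)
Definition ext (f : point -> R) (t : R) (x : 'rV[R]_n) : R :=
  if pselect (J t /\ V x) is left h then f (exist _ (t, x) h) else 0.

Lemma ext_restrict (F : R -> 'rV[R]_n -> R) :
  eqon J V F (ext (fun z => F (proj1_sig z).1 (proj1_sig z).2)).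
Proof. by move=> t x Jt Vx; rewrite /ext; case: pselect => // -[]. Qed.

Lemma ext_inj f g : eqon J V (ext f) (ext g) -> f = g.
Proof.
move=> fg; apply/funext => -[[t x] h]; have := fg t x (proj1 h) (proj2 h).
by rewrite /ext; case: pselect => // h'; rewrite (Prop_irrelevance h' h).
Qed.

Definition smooth : {pred (point -> R)} := fun f => `[< st_smooth_on J V (ext f) >].

Lemma smoothP f : reflect (st_smooth_on J V (ext f)) (f \in smooth).
Proof. exact: asboolP. Qed.

Lemma eqon_smooth (f g : R -> 'rV[R]_n -> R) :
  eqon J V f g -> st_smooth_on J V f -> st_smooth_on J V g.
Proof.
move=> fg /st_smooth_onP fk; apply/st_smooth_onP => k.
exact: (eqon_Ck (dom_open W) fg (fk k)).
Qed.

Lemma smooth_subring : subring_closed smooth.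
Proof.
have cD := @CkD R n J V (times_itv W) (times_int W) (dom_open W).
have cM := @CkM R n J V (times_itv W) (times_int W) (dom_open W).
have cc := @Ck_cst R n J V (times_itv W) (times_int W) (dom_open W).
split.
- apply/smoothP; apply: (eqon_smooth (ext_restrict (fun _ _ => 1))).
  by apply/st_smooth_onP => k; exact: cc.
- move=> f g /smoothP/st_smooth_onP fs /smoothP/st_smooth_onP gs; apply/smoothP.
  apply: (@eqon_smooth (fun t x => ext f t x + -1 * ext g t x)).
    by move=> t x Jt Vx; rewrite mulN1r /ext; case: pselect => // _; rewrite subr0.
  by apply/st_smooth_onP => k; apply: cD => //; apply: cM.
- move=> f g /smoothP/st_smooth_onP fs /smoothP/st_smooth_onP gs; apply/smoothP.
  apply: (@eqon_smooth (fun t x => ext f t x * ext g t x)).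
    by move=> t x Jt Vx; rewrite /ext; case: pselect => // _; rewrite mul0r.
  by apply/st_smooth_onP => k; apply: cM.
Qed.

Record smoothf := Smoothf { smoothf_val :> point -> R; smoothfP : smoothf_val \in smooth }.
HB.instance Definition _ := [isSub for smoothf_val].
HB.instance Definition _ := [Choice of smoothf by <:].
HB.instance Definition _ :=
  GRing.SubChoice_isSubComPzRing.Build (point -> R) smooth smoothf smooth_subring.

Definition ev (t : R) (x : 'rV[R]_n) (f : smoothf) : R := ext f t x.

Lemma ev_smooth f : st_smooth_on J V (fun t x => ev t x f).
Proof. exact/smoothP/smoothfP. Qed.

Lemma evP (f g : smoothf) : (forall t x, J t -> V x -> ev t x f = ev t x g) -> f = g.
Proof. by move=> fg; apply/val_inj/ext_inj. Qed.

Section Eval.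
Context (t : R) (x : 'rV[R]_n) (Jt : J t) (Vx : V x).

Lemma ev0 : ev t x 0 = 0. Proof. by rewrite /ev /ext; case: pselect. Qed.
Lemma ev1 : ev t x 1 = 1. Proof. by rewrite /ev /ext; case: pselect => // -[]. Qed.
Lemma evD f g : ev t x (f + g) = ev t x f + ev t x g.
Proof. by rewrite /ev /ext; case: pselect => //; rewrite addr0. Qed.
Lemma evN f : ev t x (- f) = - ev t x f.
Proof. by rewrite /ev /ext; case: pselect => //; rewrite oppr0. Qed.
Lemma evM f g : ev t x (f * g) = ev t x f * ev t x g.
Proof. by rewrite /ev /ext; case: pselect => //; rewrite mulr0. Qed.
Lemma evB f g : ev t x (f - g) = ev t x f - ev t x g.
Proof. by rewrite evD evN. Qed.
Lemma ev_nat k : ev t x k%:R = k%:R.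
Proof. by elim: k => [|k IH]; rewrite ?ev0 // !mulrS evD ev1 IH. Qed.
Lemma ev_sum (I : Type) (r : seq I) (F : I -> smoothf) :
  ev t x (\sum_(i <- r) F i) = \sum_(i <- r) ev t x (F i).
Proof. exact: (big_morph (ev t x) evD ev0). Qed.
End Eval.

Lemma smooth_of_subproof (F : R -> 'rV[R]_n -> R) : st_smooth_on J V F ->
  (fun z : point => F (proj1_sig z).1 (proj1_sig z).2) \in smooth.
Proof. by move=> Fs; apply/smoothP; exact: (eqon_smooth (ext_restrict F) Fs). Qed.

Definition smooth_of (F : R -> 'rV[R]_n -> R) (Fs : st_smooth_on J V F) : smoothf :=
  Smoothf (smooth_of_subproof Fs).

Lemma ev_smooth_of F (Fs : st_smooth_on J V F) t x : J t -> V x -> ev t x (smooth_of Fs) = F t x.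
Proof. by move=> Jt Vx; rewrite /ev -ext_restrict. Qed.

(** The space-time derivatives as operators on the ring. *)
Definition sder (a : option 'I_n) (f : smoothf) : smoothf :=
  smooth_of (st_smooth_stpd a (ev_smooth f)).

Lemma ev_sder a f t x : J t -> V x ->
  ev t x (sder a f) = stpd J a (fun t x => ev t x f) t x.
Proof. exact: ev_smooth_of. Qed.

Lemma ev_C1 (f : smoothf) : C1 J V (fun t x => ev t x f).
Proof. exact: (ev_smooth f [::]). Qed.

Lemma sder_derivation a : derivation (sder a).
Proof.
split=> f g; apply: evP => t x Jt Vx.
  rewrite evD !ev_sder // -(stpdD (times_itv W) (times_int W) a (ev_C1 f) (ev_C1 g) Jt Vx).
  by apply: (eqon_stpd (dom_open W)) => // s y _ _; rewrite evD.
rewrite evD !evM !ev_sder // -(stpdM (times_itv W) (times_int W) a (ev_C1 f) (ev_C1 g) Jt Vx).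
by apply: (eqon_stpd (dom_open W)) => // s y _ _; rewrite evM.
Qed.

Lemma sderC a b f : sder a (sder b f) = sder b (sder a f).
Proof.
apply: evP => t x Jt Vx; rewrite !ev_sder //.
transitivity (stpd J a (stpd J b (fun t x => ev t x f)) t x).
  by apply: (eqon_stpd (dom_open W)) => // s y Js Vy; rewrite ev_sder.
rewrite (stpdC (times_itv W) (times_int W) (dom_open W)) //; last exact: ev_smooth.
by apply: (eqon_stpd (dom_open W)) => // s y Js Vy; rewrite ev_sder.
Qed.

Lemma pd_ev i f F t x : J t -> V x -> (forall y, V y -> F y = ev t y f) ->
  pd i F x = ev t x (sder (Some i) f).
Proof.
move=> Jt Vx Ff; rewrite ev_sder //=; apply: near_eq_derive.
by apply: filterS (near_V (dom_open W) Vx) => y Vy; rewrite Ff.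
Qed.

Lemma has_dt_ev f F t x : J t -> V x -> (forall s, J s -> F s = ev s x f) ->
  has_dt J F t (ev t x (sder None f)).
Proof.
move=> Jt Vx Ff; rewrite ev_sder //.
apply: (eq_has_dt Jt (f := fun s => ev s x f)); first by move=> s Js; rewrite Ff.
exact: (C1_has_dt (ev_C1 f) Jt Vx).
Qed.

Lemma smooth_cst (c : R) : st_smooth_on J V (fun _ _ => c).
Proof.
by apply/st_smooth_onP => k; apply: Ck_cst; [exact: times_itv|exact: times_int|exact: dom_open].
Qed.

Definition smooth_const (c : R) : smoothf := smooth_of (smooth_cst c).

Lemma smooth_ev (f : smoothf) (F : R -> 'rV[R]_n -> R) :
  (forall t x, J t -> V x -> ev t x f = F t x) -> st_smooth_on J V F.
Proof. by move=> fF; apply: (eqon_smooth fF); exact: ev_smooth. Qed.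

Lemma smoothV (F : R -> 'rV[R]_n -> R) : (forall t x, J t -> V x -> F t x != 0) ->
  st_smooth_on J V F -> st_smooth_on J V (fun t x => (F t x)^-1).
Proof.
move=> F0 /st_smooth_onP Fk; apply/st_smooth_onP => k.
by apply: CkV => //; [exact: times_itv|exact: times_int|exact: dom_open].
Qed.

Lemma ev_prod t x (I : Type) (r : seq I) (F : I -> smoothf) : J t -> V x ->
  ev t x (\prod_(i <- r) F i) = \prod_(i <- r) ev t x (F i).
Proof. by move=> Jt Vx; apply: (big_morph (ev t x) (evM t x) (ev1 Jt Vx)). Qed.

(** The Leibniz formula exhibits a determinant as a ring element. *)
Lemma smooth_det m (F : 'I_m -> 'I_m -> R -> 'rV[R]_n -> R) :
  (forall i j, st_smooth_on J V (F i j)) ->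
  st_smooth_on J V (fun t x => \det (\matrix_(i, j) F i j t x)).
Proof.
move=> Fs; pose f i j := smooth_of (Fs i j).
apply: (@smooth_ev (\sum_(s : 'S_m) smooth_const ((-1) ^+ s) * \prod_i f i (s i))) => t x Jt Vx.
rewrite ev_sum /determinant; apply: eq_bigr => s _.
rewrite evM ev_prod // ev_smooth_of //; congr (_ * _); apply: eq_bigr => i _.
by rewrite ev_smooth_of // mxE.
Qed.

End SmoothRing.

(** * The geometry of a smooth family of metrics as ring elements *)

Section Metric.
Context {R : realType} {n : nat} (W : region R n).
Notation J := (times W).
Notation V := (dom W).
Notation ev := (@ev R n W).
Context (g : R -> tfield R n 2).
Context (g_smooth : forall I, st_smooth_on J V (fun t x => g t x I)).
Context (g_sym : forall t x i j, J t -> V x -> g t x [tuple i; j] = g t x [tuple j; i]).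
Context (g_pos : forall t x (v : 'rV[R]_n), J t -> V x -> v != 0 ->
  0 < \sum_(i < n) \sum_(j < n) g t x [tuple i; j] * v 0 i * v 0 j).

Let gmx t x : 'M[R]_n := \matrix_(k, l) g t x [tuple k; l].

(** A null vector of the matrix would have zero length. *)
Lemma det_metric t x : J t -> V x -> \det (gmx t x) != 0.
Proof.
move=> Jt Vx; apply/det0P => -[v v0 vg].
have := g_pos Jt Vx v0; suff -> : \sum_(i < n) \sum_(j < n) g t x [tuple i; j] * v 0 i * v 0 j =
    (v *m gmx t x *m v^T) 0 0 by rewrite vg mul0mx mxE ltxx.
rewrite mxE exchange_big; apply: eq_bigr => j _ /=.
rewrite !mxE mulr_suml; apply: eq_bigr => i _.
by rewrite !mxE; ring.
Qed.

Lemma metric_unit t x : J t -> V x -> gmx t x \in unitmx.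
Proof. by move=> Jt Vx; rewrite unitmxE unitfE det_metric. Qed.

(** Cramer's rule. *)
Lemma smooth_ginv i j : st_smooth_on J V (fun t x => ginv (g t) x i j).
Proof.
have gs k l : st_smooth_on J V (fun t x => g t x [tuple k; l]) by exact: g_smooth.
have ds := smoothV det_metric (smooth_det gs).
have cs := smooth_det (fun k l => gs (lift j k) (lift i l)).
apply: (@smooth_ev _ _ _
  (smooth_of ds * (smooth_const W ((-1) ^+ (j + i)) * smooth_of cs))) => t x Jt Vx.
rewrite !evM !ev_smooth_of // /ginv /invmx metric_unit // !mxE /cofactor; congr (_ * (_ * \det _)).
by apply/matrixP => k l; rewrite !mxE.
Qed.

Lemma ginv_sym t x i j : J t -> V x -> ginv (g t) x i j = ginv (g t) x j i.
Proof.
move=> Jt Vx; rewrite /ginv -/(gmx t x).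
have E : (gmx t x)^T = gmx t x by apply/matrixP => k l; rewrite !mxE g_sym.
by rewrite -[in RHS]E -trmx_inv mxE.
Qed.

Lemma ginvP t x i j : J t -> V x ->
  \sum_p g t x [tuple i; p] * ginv (g t) x p j = (i == j)%:R.
Proof.
move=> Jt Vx; have := congr1 (fun M : 'M[R]_n => M i j) (mulmxV (metric_unit Jt Vx)).
by rewrite /= !mxE => <-; apply: eq_bigr => p _; rewrite mxE.
Qed.

Let A := smoothf W.
(** Ring elements are prefixed by [s]; [sd] and [sD] are the space and time derivations. *)
Definition sG (i j : 'I_n) : A := smooth_of (g_smooth [tuple i; j]).
Definition sGi (i j : 'I_n) : A := smooth_of (smooth_ginv i j).
Definition sd (i : 'I_n) : A -> A := sder (Some i).
Definition sD : A -> A := sder None.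
Definition shalf : A := smooth_const W 2^-1.

Lemma sGC i j : sG i j = sG j i.
Proof. by apply: evP => t x Jt Vx; rewrite !ev_smooth_of // g_sym. Qed.

Lemma sGiC i j : sGi i j = sGi j i.
Proof. by apply: evP => t x Jt Vx; rewrite !ev_smooth_of // ginv_sym. Qed.

Lemma sGGi i j : \sum_p sG i p * sGi p j = (i == j)%:R.
Proof.
apply: evP => t x Jt Vx; rewrite ev_sum ev_nat // -(ginvP _ _ Jt Vx).
by apply: eq_bigr => p _; rewrite evM !ev_smooth_of.
Qed.

Lemma shalf2 : shalf + shalf = 1.
Proof. by apply: evP => t x Jt Vx; rewrite evD ev1 // ev_smooth_of //; field. Qed.

Lemma sd_der i : derivation (sd i). Proof. exact: sder_derivation. Qed.
Lemma sD_der : derivation sD. Proof. exact: sder_derivation. Qed.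
Lemma sdC i j a : sd i (sd j a) = sd j (sd i a). Proof. exact: sderC. Qed.
Lemma sDd i a : sD (sd i a) = sd i (sD a). Proof. exact: sderC. Qed.

Notation GammaA := (Gamma sd sG sGi shalf).
Notation RicA := (Ric sd sG sGi shalf).
Notation ScalA := (Scal sd sG sGi shalf).

Section AtPoint.
Context (t : R) (Jt : J t).

Lemma ev_G x i j : V x -> g t x [tuple i; j] = ev t x (sG i j).
Proof. by move=> Vx; rewrite ev_smooth_of. Qed.

Lemma ev_Gi x i j : V x -> ginv (g t) x i j = ev t x (sGi i j).
Proof. by move=> Vx; rewrite ev_smooth_of. Qed.

Lemma ev_Gamma x k i j : V x -> christoffel (g t) x k i j = ev t x (GammaA k i j).
Proof.
move=> Vx; rewrite /christoffel /Gamma evM [ev t x shalf]ev_smooth_of // ev_sum.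
congr (_ * _); apply: eq_bigr => l _; rewrite evM evB evD ev_Gi //.
by congr (_ * (_ + _ - _)); apply: pd_ev => // y Vy; rewrite ev_G.
Qed.

Lemma ev_Riem x k i j l : V x -> riem_up (g t) x k i j l = ev t x (Riem sd sG sGi shalf k i j l).
Proof.
move=> Vx; rewrite /riem_up /Riem evB evD evB !ev_sum.
congr (_ - _ + _ - _).
- by apply: pd_ev => // y Vy; exact: ev_Gamma.
- by apply: pd_ev => // y Vy; exact: ev_Gamma.
- by apply: eq_bigr => p _; rewrite evM !ev_Gamma.
- by apply: eq_bigr => p _; rewrite evM !ev_Gamma.
Qed.

Lemma ev_tr x T (T' : 'I_n -> 'I_n -> R) : V x -> (forall i j, T' i j = ev t x (T i j)) ->
  \sum_i \sum_j ginv (g t) x i j * T' i j = ev t x (tr sGi T).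
Proof.
move=> Vx TT; rewrite /tr ev_sum; apply: eq_bigr => i _; rewrite ev_sum.
by apply: eq_bigr => j _; rewrite evM TT ev_Gi.
Qed.

Lemma ev_Ric x i k : V x -> ric (g t) x i k = ev t x (RicA i k).
Proof.
move=> Vx; apply: ev_tr => // j l; rewrite /riem /Riem_low ev_sum.
by apply: eq_bigr => p _; rewrite evM ev_G // ev_Riem.
Qed.

Lemma ev_Scal x : V x -> scal (g t) x = ev t x ScalA.
Proof. by move=> Vx; apply: ev_tr => // i j; exact: ev_Ric. Qed.

End AtPoint.

End Metric.

(** * Evaluation of covariant derivatives and of quadratic tensors *)

(** On the underlying sequences the update computes, so concrete index tuples are
    handled by reduction. *)
Lemma val_upd_index n r (I : r.-tuple 'I_n) (s : 'I_r) p :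
  upd_index I s p = set_nth p I s p :> seq 'I_n.
Proof.
apply: (@eq_from_nth _ p) => [|u].
  by rewrite size_tuple size_set_nth size_tuple (maxn_idPr _).
rewrite size_tuple => ur; rewrite -(tnth_nth p _ (Ordinal ur)) tnth_mktuple nth_set_nth /=.
by rewrite -val_eqE /=; case: eqP => // _; rewrite (tnth_nth p).
Qed.

Section Tuples.
Context {n : nat}.
Implicit Types i j k l p : 'I_n.

Lemma upd_index1 i (s : 'I_1) p : upd_index [tuple i] s p = [tuple p].
Proof. by apply: val_inj; rewrite [LHS]val_upd_index ord1. Qed.

Lemma upd_index2 i j p :
  (upd_index [tuple i; j] ord0 p = [tuple p; j]) *
  (upd_index [tuple i; j] (lift ord0 ord0) p = [tuple i; p]).
Proof. by split; apply: val_inj; rewrite [LHS]val_upd_index. Qed.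

Lemma upd_index3 i j k p :
  (upd_index [tuple i; j; k] ord0 p = [tuple p; j; k]) *
  (upd_index [tuple i; j; k] (lift ord0 ord0) p = [tuple i; p; k]) *
  (upd_index [tuple i; j; k] (lift ord0 (lift ord0 ord0)) p = [tuple i; j; p]).
Proof. by do !split; apply: val_inj; rewrite [LHS]val_upd_index. Qed.

End Tuples.

Section Raise.
Context {R : realType} {n : nat} (g : tfield R n 2) (x : 'rV[R]_n).

Lemma raise2_0 T i j : raise g (0 : 'I_2) T x [tuple i; j] =
  \sum_p ginv g x i p * T x [tuple p; j].
Proof.
by apply: eq_bigr => p _; congr (_ * T x _); apply: val_inj; rewrite [LHS]val_upd_index.
Qed.

Lemma raise2_1 T i j : raise g (1 : 'I_2) T x [tuple i; j] =
  \sum_p ginv g x j p * T x [tuple i; p].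
Proof.
by apply: eq_bigr => p _; congr (_ * T x _); apply: val_inj; rewrite [LHS]val_upd_index.
Qed.

Lemma raise3_0 T i j k : raise g (0 : 'I_3) T x [tuple i; j; k] =
  \sum_p ginv g x i p * T x [tuple p; j; k].
Proof.
by apply: eq_bigr => p _; congr (_ * T x _); apply: val_inj; rewrite [LHS]val_upd_index.
Qed.

Lemma raise3_1 T i j k : raise g (1 : 'I_3) T x [tuple i; j; k] =
  \sum_p ginv g x j p * T x [tuple i; p; k].
Proof.
by apply: eq_bigr => p _; congr (_ * T x _); apply: val_inj; rewrite [LHS]val_upd_index.
Qed.

Lemma raise3_2 T i j k : raise g (2 : 'I_3) T x [tuple i; j; k] =
  \sum_p ginv g x k p * T x [tuple i; j; p].
Proof.
by apply: eq_bigr => p _; congr (_ * T x _); apply: val_inj; rewrite [LHS]val_upd_index.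
Qed.

Lemma cov_pred0 r (T : tfield R n r) k (I : r.-tuple 'I_n) K :
  thead K = k -> behead_tuple K = I ->
  cov g pred0 T x K = pd k (fun y => T y I) x -
    \sum_(s < r) \sum_p christoffel g x p k (tnth I s) * T x (upd_index I s p).
Proof. by move=> <- <-; rewrite /cov /= sumrN. Qed.

End Raise.

Section Bridge.
Context {R : realType} {n : nat} (W : region R n).
Notation J := (times W).
Notation V := (dom W).
Notation ev := (@ev R n W).
Context (g : R -> tfield R n 2).
Context (g_smooth : forall I, st_smooth_on J V (fun t x => g t x I)).
Context (g_sym : forall t x i j, J t -> V x -> g t x [tuple i; j] = g t x [tuple j; i]).
Context (g_pos : forall t x (v : 'rV[R]_n), J t -> V x -> v != 0 ->
  0 < \sum_(i < n) \sum_(j < n) g t x [tuple i; j] * v 0 i * v 0 j).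

Notation G := (sG g_smooth).
Notation Gi := (sGi g_smooth g_pos).
Notation d := (@sd R n W).
Notation half := (@shalf R n W).
Notation cov1A := (cov1 d G Gi half).
Notation cov2A := (cov2 d G Gi half).
Notation cov3A := (cov3 d G Gi half).

Context (t : R) (Jt : J t).

Lemma ev_cov0 (T : tfield R n 0) f k x : (forall y, V y -> T y [tuple] = ev t y f) -> V x ->
  cov (g t) pred0 T x [tuple k] = ev t x (d k f).
Proof.
move=> Tf Vx; rewrite (@cov_pred0 _ _ _ _ _ _ k [tuple]) //; last exact: val_inj.
by rewrite big_ord0 subr0; apply: pd_ev.
Qed.

Lemma ev_cov1 (T : tfield R n 1) v k i x :
  (forall y i, V y -> T y [tuple i] = ev t y (v i)) -> V x ->
  cov (g t) pred0 T x [tuple k; i] = ev t x (cov1A k v i).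
Proof.
move=> Tf Vx; rewrite (@cov_pred0 _ _ _ _ _ _ k [tuple i]) //; last exact: val_inj.
rewrite big_ord1 /cov1 evB ev_sum; congr (_ - _); first by apply: pd_ev => // y /Tf.
by apply: eq_bigr => p _; rewrite evM -ev_Gamma // upd_index1 Tf.
Qed.

Lemma ev_cov2 (T : tfield R n 2) S k i j x :
  (forall y i j, V y -> T y [tuple i; j] = ev t y (S i j)) -> V x ->
  cov (g t) pred0 T x [tuple k; i; j] = ev t x (cov2A k S i j).
Proof.
move=> Tf Vx; rewrite (@cov_pred0 _ _ _ _ _ _ k [tuple i; j]) //; last exact: val_inj.
rewrite !big_ord_recl big_ord0 addr0 opprD addrA /cov2 !evB !ev_sum.
congr (_ - _ - _); first by apply: pd_ev => // y /Tf.
  by apply: eq_bigr => p _; rewrite evM -ev_Gamma // upd_index2 Tf.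
by apply: eq_bigr => p _; rewrite evM -ev_Gamma // upd_index2 Tf.
Qed.

Lemma ev_cov3 (T : tfield R n 3) S k i j l x :
  (forall y i j l, V y -> T y [tuple i; j; l] = ev t y (S i j l)) -> V x ->
  cov (g t) pred0 T x [tuple k; i; j; l] = ev t x (cov3A k S i j l).
Proof.
move=> Tf Vx; rewrite (@cov_pred0 _ _ _ _ _ _ k [tuple i; j; l]) //; last exact: val_inj.
rewrite !big_ord_recl big_ord0 addr0 !opprD !addrA /cov3 !evB !ev_sum.
congr (_ - _ - _ - _); first by apply: pd_ev => // y /Tf.
- by apply: eq_bigr => p _; rewrite evM -ev_Gamma // upd_index3 Tf.
- by apply: eq_bigr => p _; rewrite evM -ev_Gamma // upd_index3 Tf.
- by apply: eq_bigr => p _; rewrite evM -ev_Gamma // upd_index3 Tf.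
Qed.

Lemma ev_hess (T : tfield R n 2) S k l i j x :
  (forall y i j, V y -> T y [tuple i; j] = ev t y (S i j)) -> V x ->
  hess (g t) T x [tuple k; l; i; j] = ev t x (cov3A k (fun l i j => cov2A l S i j) l i j).
Proof. by move=> TS Vx; apply: ev_cov3 => // y a b c Vy; exact: ev_cov2. Qed.

Lemma ev_laplacian f (F : 'rV[R]_n -> R) x : (forall y, V y -> F y = ev t y f) -> V x ->
  laplacian (g t) F x = ev t x (lap d G Gi half f).
Proof.
move=> Ff Vx; apply: ev_tr => // i j; apply: ev_cov1 => // y k Vy.
by apply: ev_cov0.
Qed.

Lemma ev_ddiv_sub_lap_tr (T : tfield R n 2) S x :
  (forall y i j, V y -> T y [tuple i; j] = ev t y (S i j)) -> V x ->
  \sum_(j < n) \sum_(l < n) \sum_(i < n) \sum_(k < n)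
    ginv (g t) x j l * ginv (g t) x i k *
    (hess (g t) T x [tuple i; l; k; j] - hess (g t) T x [tuple i; k; j; l]) =
  ev t x (ddiv_sub_lap_tr d G Gi half S).
Proof.
move=> TS Vx; rewrite /ddiv_sub_lap_tr ddiv_sub_lap_trE; last first.
- exact: shalf2.
- exact: sGGi.
- exact: sGiC.
- exact: sGC.
- exact: sd_der.
rewrite ev_sum; apply: eq_bigr => j _; rewrite ev_sum; apply: eq_bigr => l _.
rewrite ev_sum; apply: eq_bigr => i _; rewrite ev_sum; apply: eq_bigr => k _.
by rewrite !evM evB !(ev_Gi g_smooth g_pos) // !(ev_hess _ _ _ _ TS).
Qed.

(** F_i^k F_{jk} and H_{ikl} H_j^{kl}. *)
Definition sFF (F : 'I_n -> 'I_n -> smoothf W) i j :=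
  \sum_k (\sum_p Gi k p * F i p) * F j k.

Definition sHH (H : 'I_n -> 'I_n -> 'I_n -> smoothf W) i j :=
  \sum_k \sum_l H i k l * (\sum_p Gi k p * (\sum_q Gi l q * H j p q)).

Lemma ev_FF (F : tfield R n 2) S i j x :
  (forall i j, F x [tuple i; j] = ev t x (S i j)) -> V x ->
  FF (g t) F x [tuple i; j] = ev t x (sFF S i j).
Proof.
move=> FS Vx; rewrite /FF /sFF ev_sum; apply: eq_bigr => k _.
rewrite evM FS raise2_1 ev_sum; congr (_ * _); apply: eq_bigr => p _.
by rewrite evM FS (ev_Gi g_smooth g_pos).
Qed.

Lemma ev_HH (H : tfield R n 3) S i j x :
  (forall i j k, H x [tuple i; j; k] = ev t x (S i j k)) -> V x ->
  HH (g t) H x [tuple i; j] = ev t x (sHH S i j).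
Proof.
move=> HS Vx; rewrite /HH /sHH ev_sum; apply: eq_bigr => k _.
rewrite ev_sum; apply: eq_bigr => l _; rewrite evM HS raise3_1 ev_sum.
congr (_ * _); apply: eq_bigr => p _; rewrite evM raise3_2 ev_sum (ev_Gi g_smooth g_pos) //.
by congr (_ * _); apply: eq_bigr => q _; rewrite evM HS (ev_Gi g_smooth g_pos).
Qed.

End Bridge.

(** * Evolution of the scalar curvature *)

Section Contraction.
Context {R : realType} {n : nat} (g : tfield R n 2) (x : 'rV[R]_n).

Lemma contract_HH (H : tfield R n 3) p k :
  \sum_(m < n) \sum_(q < n) H x [tuple p; m; q] *
    raise g 0 (raise g 1 (raise g 2 H)) x [tuple k; m; q] =
  \sum_q ginv g x k q * HH g H x [tuple p; q].
Proof.
transitivity (\sum_q \sum_m \sum_r ginv g x k q *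
    (H x [tuple p; m; r] * raise g 1 (raise g 2 H) x [tuple q; m; r])).
  rewrite [RHS]exchange_big; apply: eq_bigr => m _; rewrite [RHS]exchange_big.
  apply: eq_bigr => r _; rewrite raise3_0 mulr_sumr; apply: eq_bigr => q _.
  by ring.
apply: eq_bigr => q _; rewrite mulr_sumr; apply: eq_bigr => m _.
by rewrite mulr_sumr.
Qed.

(** [FF] raises the contracted index of the first factor and the right-hand
    side of the evolution equation that of the second, hence the symmetry hypothesis. *)
Lemma contract_FF (F : tfield R n 2) p k :
  (forall i j, ginv g x i j = ginv g x j i) ->
  \sum_(m < n) F x [tuple p; m] * raise g 0 (raise g 1 F) x [tuple k; m] =
  \sum_q ginv g x k q * FF g F x [tuple p; q].
Proof.
move=> giC; transitivity (\sum_q \sum_m ginv g x k q *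
    (F x [tuple p; m] * raise g 1 F x [tuple q; m])).
  rewrite [RHS]exchange_big; apply: eq_bigr => m _.
  by rewrite raise2_0 mulr_sumr; apply: eq_bigr => q _; ring.
apply: eq_bigr => q _; rewrite -mulr_sumr; congr (_ * _).
transitivity (\sum_m \sum_s ginv g x m s * F x [tuple p; m] * F x [tuple q; s]).
  by apply: eq_bigr => m _; rewrite raise2_1 mulr_sumr; apply: eq_bigr => s _; ring.
rewrite exchange_big; apply: eq_bigr => s _ /=; rewrite raise2_1 mulr_suml.
by apply: eq_bigr => m _; rewrite (giC m s).
Qed.

End Contraction.

Section Flow.
Context {R : realType} {n : nat} (W : region R n).
Notation J := (times W).
Notation V := (dom W).
Notation ev := (@ev R n W).
Context (g : R -> tfield R n 2) (A : R -> tfield R n 1) (B : R -> tfield R n 2).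
Context (g_smooth : forall I, st_smooth_on J V (fun t x => g t x I)).
Context (A_smooth : forall I, st_smooth_on J V (fun t x => A t x I)).
Context (B_smooth : forall I, st_smooth_on J V (fun t x => B t x I)).
Context (g_sym : forall t x i j, J t -> V x -> g t x [tuple i; j] = g t x [tuple j; i]).
Context (g_pos : forall t x (v : 'rV[R]_n), J t -> V x -> v != 0 ->
  0 < \sum_(i < n) \sum_(j < n) g t x [tuple i; j] * v 0 i * v 0 j).
Context (g_flow : forall t x i j, J t -> V x ->
  has_dt J (fun s => g s x [tuple i; j]) t
    (- 2 * (ric (g t) x i j - 4^-1 * HH (g t) (d2 (B t)) x [tuple i; j]
            - FF (g t) (d1 (A t)) x [tuple i; j]))).

Notation G := (sG g_smooth).
Notation Gi := (sGi g_smooth g_pos).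
Notation d := (@sd R n W).
Notation D := (@sD R n W).
Notation half := (@shalf R n W).

Let sF i j : smoothf W :=
  d i (smooth_of (A_smooth [tuple j])) - d j (smooth_of (A_smooth [tuple i])).
Let sH i j k : smoothf W := d i (smooth_of (B_smooth [tuple j; k])) +
  d j (smooth_of (B_smooth [tuple k; i])) + d k (smooth_of (B_smooth [tuple i; j])).

Lemma ev_sF t x i j : J t -> V x -> d1 (A t) x [tuple i; j] = ev t x (sF i j).
Proof.
by move=> Jt Vx; rewrite evB; congr (_ - _); apply: pd_ev => // y Vy; rewrite ev_smooth_of.
Qed.

Lemma ev_sH t x i j k : J t -> V x -> d2 (B t) x [tuple i; j; k] = ev t x (sH i j k).
Proof.
move=> Jt Vx; rewrite !evD.
by congr (_ + _ + _); apply: pd_ev => // y Vy; rewrite ev_smooth_of.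
Qed.

Let sFF := sFF g_smooth g_pos sF.
Let sHH := sHH g_smooth g_pos sH.

(** The equation for the metric, as an identity of ring elements: it can then be
    differentiated. *)
Lemma sD_metric i j :
  D (G i j) = - (Ric d G Gi half i j + Ric d G Gi half i j) + (half * sHH i j + 2%:R * sFF i j).
Proof.
apply: evP => t x Jt Vx; rewrite evD evN !evD !evM ev_nat // [ev t x half]ev_smooth_of //.
rewrite ev_sder //= (has_dt_dt (times_itv W) (times_int W) Jt (l := - 2 * (ric (g t) x i j -
  4^-1 * HH (g t) (d2 (B t)) x [tuple i; j] - FF (g t) (d1 (A t)) x [tuple i; j]))).
  rewrite (ev_Ric g_smooth g_pos) // (ev_HH g_smooth g_pos Jt (S := sH)) //; last first.
    by move=> *; exact: ev_sH.
  rewrite (ev_FF g_smooth g_pos Jt (S := sF)) //; last by move=> *; exact: ev_sF.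
  by field.
by apply: (eq_has_dt Jt _ (@g_flow t x i j Jt Vx)) => s Js; rewrite ev_smooth_of.
Qed.

(** [D_Scal_flow] evaluated at a point. *)
Lemma scal_evolution t x : J t -> V x ->
  let gt := g t in let F := d1 (A t) in let H := d2 (B t) in
  has_dt J (fun s => scal (g s) x) t
    (laplacian gt (scal gt) x + 2 * ric_normsq gt x
     + 2^-1 * (\sum_(j < n) \sum_(l < n) \sum_(i < n) \sum_(k < n)
         ginv gt x j l * ginv gt x i k *
         (hess gt (HH gt H) x [tuple i; l; k; j]
          - hess gt (HH gt H) x [tuple i; k; j; l]))
     + 2 * (\sum_(j < n) \sum_(l < n) \sum_(i < n) \sum_(k < n)
         ginv gt x j l * ginv gt x i k *
         (hess gt (FF gt F) x [tuple i; l; k; j]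
          - hess gt (FF gt F) x [tuple i; k; j; l]))
     - \sum_(i < n) \sum_(p < n) \sum_(k < n)
         ginv gt x i p * ric gt x i k *
         (2^-1 * (\sum_(m < n) \sum_(q < n)
            H x [tuple p; m; q] *
            raise gt 0 (raise gt 1 (raise gt 2 H)) x [tuple k; m; q])
          + 2 * (\sum_(m < n)
            F x [tuple p; m] * raise gt 0 (raise gt 1 F) x [tuple k; m]))).
Proof.
move=> Jt Vx gt F H.
have EH y i j : V y -> HH gt H y [tuple i; j] = ev t y (sHH i j).
  by move=> Vy; apply: ev_HH => // a b c; exact: ev_sH.
have EF y i j : V y -> FF gt F y [tuple i; j] = ev t y (sFF i j).
  by move=> Vy; apply: ev_FF => // a b; exact: ev_sF.
pose ScalA := Scal d G Gi half.
set rhs := (X in has_dt _ _ _ X); suff -> : rhs = ev t x (D ScalA).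
  by apply: has_dt_ev => // s Js; exact: ev_Scal.
pose S i j := half * sHH i j + 2%:R * sFF i j.
have dder := @sd_der R n W.
have d2 i : d i 2%:R = 0 by exact: der_nat.
have dh i : d i half = 0 by apply: (der_half (dder i)); exact: shalf2.
rewrite /ScalA (D_Scal_flow dder (@sdC R n W) (sGC g_smooth g_sym)
  (sGiC g_smooth g_sym g_pos) (sGGi g_smooth g_pos) (shalf2 W) (@sD_der R n W)
  (@sDd R n W) sD_metric).
rewrite /rhs evB !evD evM ev_nat //; congr (_ - _); last first.
  rewrite ev_sum; apply: eq_bigr => i _; rewrite ev_sum; apply: eq_bigr => p _.
  rewrite ev_sum; apply: eq_bigr => k _.
  rewrite evM [X in _ = X * _]evM [X in _ = _ * X]ev_sum.
  rewrite (ev_Gi g_smooth g_pos) // (ev_Ric g_smooth g_pos) //; congr (_ * _).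
  rewrite contract_HH contract_FF; last by move=> a b; exact: (ginv_sym g_sym).
  rewrite !mulr_sumr -big_split; apply: eq_bigr => q _ /=.
  rewrite !evM evD !evM ev_nat // [ev t x half]ev_smooth_of // EH // EF //.
  by rewrite (ev_Gi g_smooth g_pos) //; ring.
rewrite -!addrA; congr (_ + (_ + _)).
- by apply: ev_laplacian => // y Vy; exact: ev_Scal.
- congr (_ * _); rewrite ev_sum; apply: eq_bigr => i _; rewrite ev_sum; apply: eq_bigr => p _.
  rewrite ev_sum; apply: eq_bigr => k _; rewrite ev_sum; apply: eq_bigr => q _.
  by rewrite !evM !(ev_Gi g_smooth g_pos) // !(ev_Ric g_smooth g_pos).
rewrite (ev_ddiv_sub_lap_tr g_smooth g_sym g_pos Jt EH Vx).
rewrite (ev_ddiv_sub_lap_tr g_smooth g_sym g_pos Jt EF Vx).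
rewrite /S ddiv_sub_lap_trD // ddiv_sub_lap_trZ // ddiv_sub_lap_trZ //.
by rewrite evD !evM ev_nat // [ev t x half]ev_smooth_of.
Qed.

End Flow.

Theorem theorem5p3 (R : realType) (n : nat) (M : manifold R n) (J : set R)
    (g : R -> chart M -> tfield R n 2) (A : R -> chart M -> tfield R n 1)
    (B : R -> chart M -> tfield R n 2)
    (M_compact : compact [set: M])
    (J_interval : is_interval J) (J_nondegenerate : J° !=set0)
    (flow : smooth_flow J g A B) :
  forall (z : M) (a : chart M) (t : R), chart_dom a z -> J t ->
    let x := chart_map a z in
    let gt := g t a in let F := d1 (A t a) in let H := d2 (B t a) in
    has_dt J (fun s => scal (g s a) x) t
      (laplacian gt (scal gt) x + 2 * ric_normsq gt x
       + 2^-1 * (\sum_(j < n) \sum_(l < n) \sum_(i < n) \sum_(k < n)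
           ginv gt x j l * ginv gt x i k *
           (hess gt (HH gt H) x [tuple i; l; k; j]
            - hess gt (HH gt H) x [tuple i; k; j; l]))
       + 2 * (\sum_(j < n) \sum_(l < n) \sum_(i < n) \sum_(k < n)
           ginv gt x j l * ginv gt x i k *
           (hess gt (FF gt F) x [tuple i; l; k; j]
            - hess gt (FF gt F) x [tuple i; k; j; l]))
       - \sum_(i < n) \sum_(p < n) \sum_(k < n)
           ginv gt x i p * ric gt x i k *
           (2^-1 * (\sum_(m < n) \sum_(q < n)
              H x [tuple p; m; q] *
              raise gt 0 (raise gt 1 (raise gt 2 H)) x [tuple k; m; q])
            + 2 * (\sum_(m < n)
              F x [tuple p; m] * raise gt 0 (raise gt 1 F) x [tuple k; m]))).
Proof.
move=> z a t az Jt.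
pose W := Region J_interval J_nondegenerate (@chart_codom_open R n M a).
have xW : dom W (chart_map a z) by exists z.
have g_smooth := (flow_g_smooth flow).2 a.
have A_smooth := (flow_A_smooth flow).2 a.
have B_smooth := (flow_B_smooth flow).2 a.
have g_riem s x (Js : J s) := flow_g_riemannian flow Js (a := a) (x := x).
apply: (@scal_evolution R n W (fun s => g s a) (fun s => A s a) (fun s => B s a)
  g_smooth A_smooth B_smooth _ _ _ t _ Jt xW).
- by move=> s x i j Js Vx; exact: (g_riem s x Js Vx).1.
- by move=> s x v Js Vx; exact: (g_riem s x Js Vx).2.
- by move=> s x i j Js Vx; have [E _ _] := flow_equations flow Js Vx; exact: E.
Qed.
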